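(* Let $\mathcal{M},\mathcal{N}\subset\mathbb{R}^n$ be two manifolds that are $\mathcal{C}^k$-smooth ($k\geq 2$) around a point $\bar{x}\in\mathcal{M}\cap\mathcal{N}$, such that $\mathcal{M}\cap\mathcal{N}$ is a $\mathcal{C}^k$-smooth manifold around $\bar{x}$ and $\mathrm{T}_{\mathcal{M}\cap\mathcal{N}}(\bar{x})=\mathrm{T}_{\mathcal{M}}(\bar{x})\cap\mathrm{T}_{\mathcal{N}}(\bar{x})$. Let the initial point $x_0$ be close enough to $\bar{x}$, and let $S=(1-\alpha)I+\alpha\,\Pi^{\alpha_2}_{\mathcal{M}}\Pi^{\alpha_1}_{\mathcal{N}}$ with parameters satisfying $\alpha\in(0,1]$, $\alpha_1,\alpha_2\in(0,2]$ and either (B1) $\alpha_1,\alpha_2\in(0,2)$, or (B2) $\alpha\in(0,1)$ with $\alpha_1\neq 2$ or $\alpha_2\neq 2$. Further assume that the same regularity conditions (both manifolds $\mathcal{C}^k$-smooth, $k\geq2$, the intersection a $\mathcal{C}^k$ manifold, and the tangent space of the intersection equal to the intersection of tangent spaces) hold at the limit point $x^*$ of the sequence $(x_k)_{k\in\mathbb{N}}$ generated by $x_{k+1}=Sx_k$. Then the convergence is R-linear to $\mathcal{M}\cap\mathcal{N}$ with any rate $\mu_{x^*}\in(\gamma(S_{\mathrm{T}(x^* )}),1)$. That is, for any $\mu_{x^*}\in(\gamma(S_{\mathrm{T}(x^* )}),1)$ there exists $N\in\mathbb{N}$ such that \[ d_{\mathcal{M}\cap\mathcal{N}}(x_k)\leq\mu_{x^*}^k,\quad\forall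 k>N. \]
   Context: For a closed nonempty set $C$, $\Pi_C$ is the projection, $\Pi_C^{\alpha}\coloneqq(1-\alpha)I+\alpha\Pi_C$ the relaxed projection, and $d_C$ the distance to $C$. $S_{\mathrm{T}(x^* )}\coloneqq(1-\alpha)I+\alpha\,\Pi^{\alpha_2}_{\mathrm{T}_{\mathcal{M}}(x^* )}\Pi^{\alpha_1}_{\mathrm{T}_{\mathcal{N}}(x^* )}$. For a matrix $A$ with spectral radius at most 1, $\gamma(A)\coloneqq\max\{|\lambda|\mid\lambda\in\{0\}\cup\Lambda(A)\setminus\{1\}\}$, with $\Lambda(A)$ the set of eigenvalues. *)

(* Defs.v *)
From HB Require Import structures.
From mathcomp Require Import all_boot all_order all_algebra.
From mathcomp Require Import all_classical all_reals all_analysis.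
Set Implicit Arguments. Unset Strict Implicit. Unset Printing Implicit Defensive.
Import Order.TTheory GRing.Theory Num.Theory.
Import numFieldNormedType.Exports.
Local Open Scope classical_set_scope.
Local Open Scope ring_scope.

Section Defs.
Variable R : realType.

Definition enorm n (x : 'rV[R]_n) : R := Num.sqrt (\sum_(i < n) x ord0 i ^+ 2).

Definition is_proj n (C : set 'rV[R]_n) (x y : 'rV[R]_n) : Prop :=
  C y /\ forall z, C z -> enorm (x - y) <= enorm (x - z).

Definition dist_set n (C : set 'rV[R]_n) (x : 'rV[R]_n) : R :=
  inf [set enorm (x - c) | c in C].

Fixpoint Ck {V W : normedModType R} (k : nat) (U : set V) (f : V -> W) : Prop :=
  match k with
  | 0 => forall x, U x -> {for x, continuous f}
  | k'.+1 => (forall x v, U x -> derivable f x v) /\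
             forall v, Ck k' U (fun x => 'D_v f x)
  end.

Definition ck_manifold_around n (k : nat) (C : set 'rV[R]_n) (xb : 'rV[R]_n) : Prop :=
  C xb /\
  exists (U : set 'rV[R]_n) (m : nat) (F : 'rV[R]_n -> 'rV[R]_m),
    open U /\ U xb /\ Ck k U F /\
    C `&` U = [set x | U x /\ F x = 0] /\
    forall x, C x -> U x -> forall w : 'rV[R]_m, exists v, 'D_v F x = w.

Definition tangent n (C : set 'rV[R]_n) (x : 'rV[R]_n) : set 'rV[R]_n :=
  [set v | exists c : R -> 'rV[R]_n,
     c 0 = x /\ (\forall t \near (0:R), C (c t)) /\ is_derive (0:R) (1:R) c v].

Definition regular_at n (k : nat) (M N : set 'rV[R]_n) (x : 'rV[R]_n) : Prop :=
  ck_manifold_around k M x /\ ck_manifold_around k N x /\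
  ck_manifold_around k (M `&` N) x /\
  tangent (M `&` N) x = tangent M x `&` tangent N x.

Definition is_proj_mx n (T : set 'rV[R]_n) (P : 'M[R]_n) : Prop :=
  forall x, is_proj T x (x *m P).

(* a + b i is a (complex) eigenvalue of the real matrix A, acting on rows:
   (u + i v) A = (a + b i)(u + i v) with u + i v <> 0 *)
Definition is_eigenvalue n (A : 'M[R]_n) (a b : R) : Prop :=
  exists u v : 'rV[R]_n, (u != 0 \/ v != 0) /\
    u *m A = a *: u - b *: v /\ v *m A = b *: u + a *: v.

Definition gamma n (A : 'M[R]_n) : R :=
  sup ([set 0] `|` [set Num.sqrt (ab.1 ^+ 2 + ab.2 ^+ 2) | ab in
        [set ab : R * R | is_eigenvalue A ab.1 ab.2 /\ ab <> (1, 0)]]).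

(* one step x' = S x, S = (1-al) I + al Pi^{al2}_M Pi^{al1}_N, with the
   (possibly set-valued) projections resolved by any selection *)
Definition S_step n (M N : set 'rV[R]_n) (al al1 al2 : R) (x x' : 'rV[R]_n) : Prop :=
  exists y1 y2, is_proj N x y1 /\
    let z := (1 - al1) *: x + al1 *: y1 in
    is_proj M z y2 /\
    x' = (1 - al) *: x + al *: ((1 - al2) *: z + al2 *: y2).

(* the linearized operator S_T at the limit point, as a matrix acting on rows *)
Definition S_T_mx n (PM PN : 'M[R]_n) (al al1 al2 : R) : 'M[R]_n :=
  (1 - al) *: 1%:M +
  al *: (((1 - al1) *: 1%:M + al1 *: PN) *m ((1 - al2) *: 1%:M + al2 *: PM)).

End Defs.

(* Main.v *)
Require Import Defs.
From HB Require Import structures.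
From mathcomp Require Import all_boot all_order all_algebra.
From mathcomp Require Import all_classical all_reals all_analysis.
From mathcomp Require Import ring lra.
From mathcomp.real_closed Require Import complex.
Import Order.TTheory GRing.Theory Num.Theory.
Import numFieldNormedType.Exports.
Local Open Scope classical_set_scope.
Local Open Scope ring_scope.
Set Implicit Arguments. Unset Strict Implicit. Unset Printing Implicit Defensive.

(* Near the limit point xs only the first-order geometry of a smooth set C matters:
   with P the orthogonal projection onto its tangent space, chords of C are tangent to
   the range of P up to o(length), and every small tangent step y + v from y in C can be
   corrected back into C at cost o(|v|). The second fact is an error bound
   d(z, C) <= K |F z|, obtained by minimising |F w| + c |w - z| over a ball. Comparing a nearest
   point with such corrected tangent steps gives, uniformly for z and p in C near xs,
     proj_C z - p = (z - p) P + o(|z - p|),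
   for any selection of the projection. Hence x_(k+m) - p = (x_k - p) S^m + o(|x_k - p|)
   for p in the intersection, where S is the linearised operator.

   Take p nearest to x_k in the intersection and let Q be the projection onto
   T_M /\ T_N: then (x_k - p) Q = o(|x_k - p|), so S may be replaced by S - Q. The
   fixed vectors of S are exactly T_M /\ T_N, so the eigenvalues of S - Q are 0 or
   eigenvalues of S other than 1, all of modulus at most gamma S; Cayley-Hamilton over
   R[i] turns this into |(S - Q)^m| <= C rho^m for every rho > gamma S. For a large
   fixed m the distance to the intersection therefore contracts by s^m every m steps. *)

(** * Euclidean norm and orthogonal projections *)

Section Euclidean.
Context {R : realType}.
Implicit Types n m : nat.

Definition dot {n} (x y : 'rV[R]_n) : R := \sum_(i < n) x ord0 i * y ord0 i.

Lemma dotC n (x y : 'rV[R]_n) : dot x y = dot y x.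
Proof. by apply: eq_bigr => i _; rewrite mulrC. Qed.

Lemma dotDl n (x y z : 'rV[R]_n) : dot (x + y) z = dot x z + dot y z.
Proof. by rewrite -big_split; apply: eq_bigr => i _; rewrite mxE mulrDl. Qed.

Lemma dotZl n a (x y : 'rV[R]_n) : dot (a *: x) y = a * dot x y.
Proof. by rewrite mulr_sumr; apply: eq_bigr => i _; rewrite mxE mulrA. Qed.

Lemma dotDr n (x y z : 'rV[R]_n) : dot x (y + z) = dot x y + dot x z.
Proof. by rewrite !(dotC x) dotDl. Qed.

Lemma dotZr n a (x y : 'rV[R]_n) : dot x (a *: y) = a * dot x y.
Proof. by rewrite !(dotC x) dotZl. Qed.

Lemma dotNl n (x y : 'rV[R]_n) : dot (- x) y = - dot x y.
Proof. by rewrite -scaleN1r dotZl mulN1r. Qed.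

Lemma dotNr n (x y : 'rV[R]_n) : dot x (- y) = - dot x y.
Proof. by rewrite !(dotC x) dotNl. Qed.

Definition dotE := (dotDl, dotDr, dotNl, dotNr, dotZl, dotZr).

Lemma dot_mulmx n m (x : 'rV[R]_n) (A : 'M[R]_(n, m)) y :
  dot (x *m A) y = dot x (y *m A^T).
Proof.
rewrite /dot; under eq_bigr do rewrite mxE mulr_suml.
rewrite exchange_big; apply: eq_bigr => i _.
by rewrite mxE mulr_sumr; apply: eq_bigr => j _; rewrite mxE; ring.
Qed.

Lemma dot_ge0 n (x : 'rV[R]_n) : 0 <= dot x x.
Proof. by apply: sumr_ge0 => i _; rewrite -expr2 sqr_ge0. Qed.

Lemma dot_eq0 n (x : 'rV[R]_n) : dot x x = 0 -> x = 0.
Proof.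
move=> /eqP; rewrite psumr_eq0; last by move=> i _; rewrite -expr2 sqr_ge0.
move=> /allP h; apply/rowP => i; rewrite mxE.
by have := h i (mem_index_enum _); rewrite /= mulf_eq0 orbb => /eqP.
Qed.

Lemma sqr_enorm n (x : 'rV[R]_n) : enorm x ^+ 2 = dot x x.
Proof. by rewrite sqr_sqrtr// sumr_ge0// => i _; rewrite sqr_ge0. Qed.

Lemma enorm_ge0 n (x : 'rV[R]_n) : 0 <= enorm x.
Proof. exact: sqrtr_ge0. Qed.

Hint Resolve enorm_ge0 : core.

Lemma enorm_eq0 n (x : 'rV[R]_n) : enorm x = 0 -> x = 0.
Proof. by move=> h; apply: dot_eq0; rewrite -sqr_enorm h expr0n. Qed.

Lemma enormP n (x : 'rV[R]_n) c : 0 <= c -> (enorm x <= c) = (dot x x <= c ^+ 2).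
Proof. by move=> c0; rewrite -sqr_enorm ler_pXn2r ?nnegrE. Qed.

Lemma enorm0 n : enorm (0 : 'rV[R]_n) = 0.
Proof.
by apply/eqP; rewrite eq_le enorm_ge0 andbT enormP// -(scale0r 0) dotZl; lra.
Qed.

Lemma enormZ n a (x : 'rV[R]_n) : enorm (a *: x) = `|a| * enorm x.
Proof.
apply/eqP; rewrite -(@eqrXn2 _ 2) ?mulr_ge0//.
by rewrite exprMn !sqr_enorm dotZl dotZr real_normK ?num_real// mulrA -expr2.
Qed.

Lemma enormN n (x : 'rV[R]_n) : enorm (- x) = enorm x.
Proof. by rewrite -scaleN1r enormZ normrN1 mul1r. Qed.

Lemma enormB n (x y : 'rV[R]_n) : enorm (x - y) = enorm (y - x).
Proof. by rewrite -enormN opprB. Qed.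

(** Cauchy-Schwarz: expand the square of [enorm y *: x - enorm x *: y] and divide by
    [enorm x * enorm y]. *)
Lemma dot_le n (x y : 'rV[R]_n) : dot x y <= enorm x * enorm y.
Proof.
have [x0|x0] := eqVneq (enorm x) 0.
  by rewrite (enorm_eq0 x0) -(scale0r 0) dotZl mul0r mulr_ge0.
have [y0|y0] := eqVneq (enorm y) 0.
  by rewrite (enorm_eq0 y0) -(scale0r 0) dotZr mul0r mulr_ge0.
have := dot_ge0 (enorm y *: x - enorm x *: y).
rewrite !dotE (dotC y x) -!sqr_enorm => h.
have xp : 0 < enorm x * enorm y by rewrite mulr_gt0// lt_neqAle eq_sym ?x0 ?y0 enorm_ge0.
rewrite -subr_ge0 -(pmulr_rge0 _ xp).
by move: h; nra.
Qed.

Lemma ler_enormD n (x y : 'rV[R]_n) : enorm (x + y) <= enorm x + enorm y.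
Proof.
rewrite enormP ?addr_ge0// !dotE (dotC y x) -!sqr_enorm.
by have := dot_le x y; nra.
Qed.

Lemma ler_enormB n (x y z : 'rV[R]_n) :
  enorm (x - z) <= enorm (x - y) + enorm (y - z).
Proof. by apply: le_trans (ler_enormD _ _); rewrite addrA subrK. Qed.

Lemma ler_enorm_sum n I (s : seq I) (P : pred I) (F : I -> 'rV[R]_n) :
  enorm (\sum_(i <- s | P i) F i) <= \sum_(i <- s | P i) enorm (F i).
Proof.
elim/big_ind2: _ => [|x a y b xa yb|//]; first by rewrite enorm0.
by apply: (le_trans (ler_enormD _ _)); apply: lerD.
Qed.

Lemma ler_coord_enorm n (x : 'rV[R]_n) i : `|x ord0 i| <= enorm x.
Proof.
rewrite -(ler_pXn2r (n := 2)) ?nnegrE// real_normK ?num_real// sqr_enorm /dot.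
rewrite (bigD1 i)//= -expr2 lerDl sumr_ge0// => j _.
by rewrite -expr2 sqr_ge0.
Qed.

Lemma ler_enorm_coord n (x y : 'rV[R]_n) :
  (forall i, `|x ord0 i| <= `|y ord0 i|) -> enorm x <= enorm y.
Proof.
move=> h; rewrite enormP// sqr_enorm; apply: ler_sum => i _.
rewrite -!expr2 -(real_normK (num_real (x _ _))) -(real_normK (num_real (y _ _))).
by rewrite ler_pXn2r ?nnegrE.
Qed.

Lemma enorm_delta n i : enorm (delta_mx ord0 i : 'rV[R]_n) = 1.
Proof.
rewrite /enorm (bigD1 i)//= big1 => [|j ji]; rewrite mxE eqxx.
  by rewrite eqxx expr1n addr0 sqrtr1.
by rewrite (negbTE ji) expr0n.
Qed.

Lemma ler_enorm_sumcoord n (x : 'rV[R]_n) : enorm x <= \sum_(i < n) `|x ord0 i|.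
Proof.
rewrite {1}(row_sum_delta x); apply: (le_trans (ler_enorm_sum _ _ _)).
by apply: ler_sum => i _; rewrite enormZ enorm_delta mulr1.
Qed.

(** The summand [1] in the constant keeps it positive, so that later tolerances can be divided by
    it. *)
Lemma mulmx_bounded n m (A : 'M[R]_(n, m)) :
  exists2 K, 0 < K & forall v, enorm (v *m A) <= K * enorm v.
Proof.
exists (1 + \sum_i enorm (row i A)) => [|v].
  by rewrite ltr_pwDl// sumr_ge0.
rewrite {1}(row_sum_delta v) mulmx_suml mulrDl mul1r.
apply: (le_trans (ler_enorm_sum _ _ _)); apply: ler_wpDl => //.
rewrite mulr_suml; apply: ler_sum => i _.
by rewrite -scalemxAl -rowE enormZ mulrC ler_wpM2l// ler_coord_enorm.
Qed.

Definition orthoproj n (P : 'M[R]_n) := P^T = P /\ P *m P = P.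

Lemma orthoproj_dot n (P : 'M[R]_n) (x y : 'rV[R]_n) : orthoproj P ->
  dot (x *m P) (y - y *m P) = 0.
Proof.
by move=> [Pt PP]; rewrite dot_mulmx Pt mulmxBl -mulmxA PP subrr -(scale0r 0) dotZr mul0r.
Qed.

Lemma orthoproj_pythagoras n (P : 'M[R]_n) (x : 'rV[R]_n) a b : orthoproj P ->
  enorm (a *: (x *m P) + b *: (x - x *m P)) ^+ 2 =
    a ^+ 2 * enorm (x *m P) ^+ 2 + b ^+ 2 * enorm (x - x *m P) ^+ 2.
Proof.
move=> hP; have := orthoproj_dot x x hP.
rewrite !sqr_enorm; move: (x *m P) (x - _) => u v uv.
by rewrite !dotE (dotC v u) uv; ring.
Qed.

Lemma orthoproj_enorm n (P : 'M[R]_n) (x : 'rV[R]_n) : orthoproj P ->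
  enorm x ^+ 2 = enorm (x *m P) ^+ 2 + enorm (x - x *m P) ^+ 2.
Proof.
by move=> /(orthoproj_pythagoras x 1 1); rewrite !scale1r addrC subrK expr1n !mul1r.
Qed.

Lemma orthoproj_le n (P : 'M[R]_n) (x : 'rV[R]_n) : orthoproj P ->
  enorm (x *m P) <= enorm x.
Proof.
move=> /(orthoproj_enorm x) h; rewrite -(ler_pXn2r (n := 2)) ?nnegrE// h lerDl.
exact: sqr_ge0.
Qed.

Lemma orthoproj_compl_le n (P : 'M[R]_n) (x : 'rV[R]_n) : orthoproj P ->
  enorm (x - x *m P) <= enorm x.
Proof.
move=> /(orthoproj_enorm x) h; rewrite -(ler_pXn2r (n := 2)) ?nnegrE ?enorm_ge0// h lerDr.
exact: sqr_ge0.
Qed.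

(** By Pythagoras, |x - xP'|^2 exceeds |x - xP|^2 by |xP - xP'|^2, so nearest points in the range of
    [P] are unique. This identifies a prescribed tangent projection with one built from defining
    equations. *)
Lemma is_proj_mx_orthoproj n (T : set 'rV[R]_n) (P P' : 'M[R]_n) : orthoproj P ->
  (forall v, T v <-> v *m P = v) -> is_proj_mx T P' -> P' = P.
Proof.
move=> hP TP hP'; apply/row_matrixP => i; rewrite !rowE; set x := delta_mx _ _.
have [/TP h1 h2] := hP' x; have [_ PP] := hP.
have {h2} := h2 (x *m P); rewrite TP -mulmxA PP => /(_ erefl).
rewrite -(ler_pXn2r (n := 2)) ?nnegrE// (orthoproj_enorm (x - x *m P') hP).
rewrite mulmxBl h1 opprB addrA subrK => h.
have /eqP : enorm (x *m P - x *m P') ^+ 2 = 0.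
  by apply/eqP; rewrite eq_le sqr_ge0 andbT; lra.
by rewrite sqrf_eq0 => /eqP/enorm_eq0/eqP; rewrite subr_eq0 => /eqP.
Qed.

(** [B] is the pseudo-inverse (A^T A)^-1 A^T, a right inverse of the row map v -> vA; A B projects
    orthogonally onto the complement of its kernel. *)
Lemma orthoproj_kernel n m (A : 'M[R]_(n, m)) :
  (forall w : 'rV_m, exists v : 'rV_n, v *m A = w) ->
  exists (B : 'M[R]_(m, n)) (P : 'M[R]_n),
    [/\ B *m A = 1%:M, P = 1%:M - A *m B, orthoproj P &
      forall v : 'rV_n, v *m A = 0 <-> v *m P = v].
Proof.
move=> surj.
have inj (w : 'rV_m) : w *m (A^T *m A) = 0 -> w = 0.
  move=> h; have : w *m A^T = 0.
    by apply: dot_eq0; rewrite dot_mulmx trmxK -mulmxA h -(scale0r 0) dotZr mul0r.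
  move=> h'; have [v vA] := surj w; apply: dot_eq0.
  by rewrite -{1}vA dot_mulmx h' -(scale0r 0) dotZr mul0r.
have un : A^T *m A \in unitmx.
  rewrite -row_free_unit -kermx_eq0; apply/eqP/row_matrixP => i.
  by rewrite row0; apply: inj; rewrite -row_mul mulmx_ker row0.
set B := invmx (A^T *m A) *m A^T.
have BA : B *m A = 1%:M by rewrite -mulmxA mulVmx.
exists B, (1%:M - A *m B); split => //.
  split.
    rewrite linearB /= trmx1 trmx_mul [in X in _ - X *m _]trmx_mul trmxK trmx_inv.
    by rewrite trmx_mul trmxK mulmxA.
  by rewrite mulmxBl mul1mx mulmxBr mulmx1 -mulmxA (mulmxA B) BA mul1mx subrr subr0.
move=> v; rewrite mulmxBr mulmx1 mulmxA; split => [->|/eqP].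
  by rewrite mul0mx subr0.
rewrite -subr_eq0 addrAC subrr add0r oppr_eq0 => /eqP.
by move/(congr1 (mulmx^~ A)) => /=; rewrite -(mulmxA (v *m A)) BA mulmx1 mul0mx.
Qed.

End Euclidean.
#[global] Hint Extern 0 (is_true (_ <= enorm _)) => exact: enorm_ge0 : core.

(** * Minimisation and nearest points *)

Section Topology.
Context {R : realType}.
Implicit Types n m : nat.

Lemma ler_norm_enorm n (x : 'rV[R]_n) : `|x| <= enorm x.
Proof.
rewrite [leLHS]/Num.Def.normr/= mx_normrE; apply: bigmax_le => [|[i j] _]; first exact: enorm_ge0.
by rewrite /= ord1 ler_coord_enorm.
Qed.

Lemma ler_enorm_norm n (x : 'rV[R]_n) : enorm x <= n%:R * `|x|.
Proof.
apply: (le_trans (ler_enorm_sumcoord x)).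
rewrite -[X in X%:R]card_ord mulr_natl -sumr_const; apply: ler_sum => i _.
rewrite [leRHS]/Num.Def.normr/= mx_normrE.
exact: (le_bigmax _ _ (ord0, i)).
Qed.

(** The topology on rows comes from the sup norm; the two preceding comparisons transfer it to the
    Euclidean norm. *)
Lemma nbhs_enormP n (x : 'rV[R]_n) (U : set 'rV[R]_n) :
  nbhs x U <-> exists2 r, 0 < r & forall y, enorm (y - x) < r -> U y.
Proof.
split => [/nbhs_ballP[r /= r0 rU]|[r r0 rU]]; last first.
  apply/nbhs_ballP; exists (r / n.+1%:R) => /=; first by rewrite divr_gt0.
  move=> y; rewrite -ball_normE /= => xy; apply: rU; rewrite enormB.
  apply: (le_lt_trans (ler_enorm_norm _)).
  rewrite ltr_pdivlMr// in xy; apply: le_lt_trans xy.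
  by rewrite mulrC ler_wpM2l// ler_nat.
exists r => // y yx; apply: rU; rewrite -ball_normE /=.
by apply: le_lt_trans (ler_norm_enorm _) _; rewrite enormB.
Qed.

Lemma cvg_enormP n (x : nat -> 'rV[R]_n) (l : 'rV[R]_n) : x @ \oo --> l ->
  forall e, 0 < e -> exists N, forall j, (N <= j)%N -> enorm (x j - l) < e.
Proof.
move=> xl e e0; have /xl [N _ h] : nbhs l [set y | enorm (y - l) < e].
  by apply/nbhs_enormP; exists e.
by exists N => j Nj; exact: h.
Qed.

Lemma lipschitz_min n (K : set 'rV[R]_n) (g : 'rV[R]_n -> R) x0 r L :
  K !=set0 -> closed K -> (forall w, K w -> enorm (w - x0) <= r) ->
  (forall w w', K w -> K w' -> g w - g w' <= L * enorm (w - w')) ->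
  exists2 w, K w & forall w', K w' -> g w <= g w'.
Proof.
move=> K0 cK bK lip.
have cptK : compact K.
  apply: bounded_closed_compact => //.
  exists (r + enorm x0); split; first exact: num_real.
  move=> M rM w /bK wr; apply: ltW; apply: (le_lt_trans _ rM).
  apply: (le_trans (ler_norm_enorm _)).
  have -> : w = (w - x0) + x0 by rewrite subrK.
  by apply: (le_trans (ler_enormD _ _)); rewrite lerD2r.
have cg : {within K, continuous g}.
  apply/subspace_continuousP => w Kw; apply/cvgrPdist_lt => e e0.
  have L0 : 0 < `|L| + 1 by rewrite ltr_wpDl.
  apply/nbhs_enormP; exists (e / (`|L| + 1)); first by rewrite divr_gt0.
  move=> y; rewrite ltr_pdivlMr// mulrC => yw Ky.
  have bd z z' : K z -> K z' -> enorm (z - z') = enorm (y - w) -> g z - g z' < e.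
    move=> Kz Kz' zz; apply: le_lt_trans yw; apply: (le_trans (lip _ _ Kz Kz')).
    by rewrite zz ler_wpM2r// (le_trans (ler_norm _))// lerDl.
  rewrite ltr_norml ltrNl opprB !bd//; exact: enormB.
have [w /set_mem Kw h] := EVT_min_rV K0 cptK cg.
by exists w => // w' Kw'; apply: h; exact/mem_set.
Qed.

Lemma closed_enorm_ball n (x0 : 'rV[R]_n) r : closed [set w | enorm (w - x0) <= r].
Proof.
rewrite -(setCK [set w | _]); apply: open_closedC; rewrite openE => w /= /negP.
rewrite -ltNge => rw; apply/nbhs_enormP; exists (enorm (w - x0) - r).
  by rewrite subr_gt0.
move=> y yw /=; apply/negP; rewrite -ltNge.
by have := ler_enormB w y x0; rewrite (enormB w y); lra.
Qed.

(** Only points of [C] no farther from [x] than some chosen [c] compete, and they form a compact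
    set. *)
Lemma nearest_point n (C : set 'rV[R]_n) x : closed C -> C !=set0 ->
  exists p, is_proj C x p.
Proof.
move=> cC [c Cc]; set r := enorm (c - x).
have [||||w [Cw wr] h] := @lipschitz_min n (C `&` [set w | enorm (w - x) <= r])
  (fun w => enorm (w - x)) x r 1.
- by exists c; split => //=.
- by apply: closedI => //; exact: closed_enorm_ball.
- by move=> w [].
- by move=> w w' _ _; rewrite mul1r lerBlDr; exact: ler_enormB.
exists w; split => // z Cz; rewrite !(enormB x).
have [zr|/ltW rz] := leP (enorm (z - x)) r; first by apply: h.
exact: le_trans rz.
Qed.

Lemma dist_set_le n (C : set 'rV[R]_n) x c : C c -> dist_set C x <= enorm (x - c).
Proof.
move=> Cc; apply: ge_inf; last by exists c.
by exists 0 => _ [z _ <-].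
Qed.

Lemma dist_set_proj n (C : set 'rV[R]_n) x p : is_proj C x p ->
  dist_set C x = enorm (x - p).
Proof.
move=> [Cp h]; apply/eqP; rewrite eq_le dist_set_le//=.
apply: lb_le_inf; first by exists (enorm (x - p)), p.
by move=> _ [z Cz <-]; exact: h.
Qed.

End Topology.

(** * Strict differentiability *)

Section StrictDifferentiability.
Context {R : realType}.
Implicit Types n m : nat.

(** Both points vary near [x] while [A] stays fixed; this uniformity is needed because base points
    will move along the sets. *)
Definition strict_diff n m (f : 'rV[R]_n -> 'rV[R]_m) (x : 'rV[R]_n) (A : 'M[R]_(n, m)) :=
  forall e, 0 < e -> exists2 r, 0 < r & forall y y',
    enorm (y - x) < r -> enorm (y' - x) < r ->
    enorm (f y' - f y - (y' - y) *m A) <= e * enorm (y' - y).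

Lemma is_derive_line n (f : 'rV[R]_n -> R) (y v : 'rV[R]_n) t :
  derivable f (y + t *: v) v ->
  is_derive t (1 : R) (fun s => f (y + s *: v)) ('D_v f (y + t *: v)).
Proof.
move=> df.
have E : (fun h : R => h^-1 *: (((fun s => f (y + s *: v)) \o shift t) (h *: 1)
           - f (y + t *: v)))
  = (fun h : R => h^-1 *: ((f \o shift (y + t *: v)) (h *: v) - f (y + t *: v))).
  apply/funext => h /=; congr (_ *: (f _ - _)).
  by rewrite [h *: 1]mulr1 scalerDl addrCA.
by split; rewrite /derivable /derive E.
Qed.

Lemma derive_increment_ge0 n (f : 'rV[R]_n -> R) (y v : 'rV[R]_n) s l e :
  0 <= s ->
  (forall t, 0 <= t <= s -> derivable f (y + t *: v) v /\
     `|'D_v f (y + t *: v) - l| <= e) ->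
  `|f (y + s *: v) - f y - s * l| <= e * s.
Proof.
move=> s0 h.
have dg t : 0 <= t <= s ->
    is_derive t (1 : R) (fun s => f (y + s *: v)) ('D_v f (y + t *: v)).
  by move=> /h[+ _]; exact: is_derive_line.
have [||c] := @MVT_segment R (fun s => f (y + s *: v))
    (fun t => 'D_v f (y + t *: v)) 0 s s0.
- by move=> t; rewrite in_itv /= => /andP[t0 ts]; apply: dg; rewrite !ltW.
- apply: derivable_within_continuous => t; rewrite in_itv /= => ts.
  exact: (@ex_derive _ _ _ _ _ _ _ (dg t ts)).
rewrite in_itv /= => cs; rewrite scale0r addr0 subr0 => ->.
rewrite [s * l]mulrC -mulrBl normrM (ger0_norm s0) ler_wpM2r//.
by have [] := h c cs.
Qed.

Lemma derive_increment n (f : 'rV[R]_n -> R) (y v : 'rV[R]_n) s l e :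
  (forall t, `|t| <= `|s| -> derivable f (y + t *: v) v /\
     `|'D_v f (y + t *: v) - l| <= e) ->
  `|f (y + s *: v) - f y - s * l| <= e * `|s|.
Proof.
move=> h; have [s0|s0] := leP 0 s.
  rewrite (ger0_norm s0); apply: derive_increment_ge0 => // t /andP[t0 ts].
  by apply: h; rewrite !ger0_norm.
rewrite (ltr0_norm s0) -normrN.
have -> : - (f (y + s *: v) - f y - s * l) =
    f (y + s *: v + (- s) *: v) - f (y + s *: v) - - s * l.
  by rewrite scaleNr addrK; ring.
apply: derive_increment_ge0 => [|t /andP[t0 ts]]; first by rewrite oppr_ge0 ltW.
by rewrite -addrA -scalerDl; apply: h; rewrite ler0_norm ?(ltr0_norm s0); lra.
Qed.

Definition trunc_row n (h : 'rV[R]_n) k : 'rV[R]_n :=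
  \row_(j < n) (if (j < k)%N then h ord0 j else 0).

Lemma trunc_row0 n (h : 'rV[R]_n) : trunc_row h 0 = 0.
Proof. by apply/rowP => j; rewrite !mxE ltn0. Qed.

Lemma trunc_row_size n (h : 'rV[R]_n) : trunc_row h n = h.
Proof. by apply/rowP => j; rewrite !mxE ltn_ord. Qed.

Lemma trunc_rowS n (h : 'rV[R]_n) (i : 'I_n) :
  trunc_row h i.+1 = trunc_row h i + h ord0 i *: delta_mx ord0 i.
Proof.
apply/rowP => j; rewrite !mxE eqxx /= ltnS leq_eqVlt.
have [->|ji] := eqVneq j i; first by rewrite eqxx ltnn mulr1 add0r.
by rewrite -val_eqE in ji; rewrite (negbTE ji) mulr0 addr0.
Qed.

(** Go from [y] to [y + h] one coordinate at a time and apply the mean value estimate on each leg.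
    Every intermediate displacement is dominated coordinatewise by [h], so it lies in the region
    where the partial derivatives are controlled. *)
Lemma strict_diff_coord n (f : 'rV[R]_n -> R) (y h : 'rV[R]_n) (a : 'I_n -> R) e :
  (forall q, enorm q <= enorm h -> forall i : 'I_n,
     derivable f (y + q) (delta_mx ord0 i) /\
     `|'D_(delta_mx ord0 i) f (y + q) - a i| <= e) ->
  `|f (y + h) - f y - \sum_i h ord0 i * a i| <= n%:R * e * enorm h.
Proof.
move=> H.
have -> : f (y + h) - f y =
    \sum_(i < n) (f (y + trunc_row h i.+1) - f (y + trunc_row h i)).
  rewrite -(big_mkord xpredT (fun i => f (y + trunc_row h i.+1) - f (y + trunc_row h i))).
  by rewrite telescope_sumr// trunc_row0 trunc_row_size addr0.
rewrite -sumrB; apply: (le_trans (ler_norm_sum _ _ _)).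
rewrite -mulrA mulr_natl -[X in _ *+ X]card_ord -sumr_const; apply: ler_sum => i _.
have e0 : 0 <= e.
  by apply: le_trans (normr_ge0 _) (H 0 _ i).2; rewrite enorm0.
rewrite trunc_rowS addrA; apply: (@le_trans _ _ (e * `|h ord0 i|)); last first.
  by rewrite ler_wpM2l// ler_coord_enorm.
apply: derive_increment => t th; rewrite -addrA; apply: H.
apply: ler_enorm_coord => j; rewrite !mxE eqxx /=.
have [->|ji] := eqVneq j i; first by rewrite ltnn mulr1 add0r.
by rewrite mulr0 addr0; case: ifP => //; rewrite normr0.
Qed.

Lemma C1_strict_diff n m (f : 'rV[R]_n -> 'rV[R]_m) (U : set 'rV[R]_n) x :
  open U -> U x -> (forall y v, U y -> derivable f y v) ->
  (forall v y, U y -> {for y, continuous (fun z => 'D_v f z)}) ->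
  exists2 A, strict_diff f x A & forall v, 'D_v f x = v *m A.
Proof.
move=> oU Ux df cf.
pose A : 'M[R]_(n, m) := \matrix_(i, j) 'D_(delta_mx ord0 i) f x ord0 j.
have sA : strict_diff f x A.
  (* The error is summed over [m] components and [n] coordinates; the [+ 1] keeps the denominator
     positive. *)
  move=> e e0; pose eta := e / (m%:R * n%:R + 1).
  have mn0 : 0 < m%:R * n%:R + 1 :> R by rewrite ltr_wpDl// mulr_ge0.
  have eta0 : 0 < eta by rewrite divr_gt0.
  have : nbhs x (U `&` [set z | forall i : 'I_n,
      `|'D_(delta_mx ord0 i) f x - 'D_(delta_mx ord0 i) f z| < eta]).
    apply: filterI; first exact: open_nbhs_nbhs.
    have := @filter_forall _ _ (fun (i : 'I_n) z =>
      `|'D_(delta_mx ord0 i) f x - 'D_(delta_mx ord0 i) f z| < eta) (nbhs x) _.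
    apply => i.
    by have /cvgrPdist_lt/(_ _ eta0) := cf (delta_mx ord0 i) x Ux.
  (* With both points within r/3 of [x], the step [h] is shorter than 2r/3, so the whole path stays
     within [r]. *)
  move=> /nbhs_enormP[r r0 hr]; exists (r / 3%:R); first by rewrite divr_gt0.
  move=> y y' yx y'x; set h := y' - y; have y'E : y' = y + h by rewrite addrC subrK.
  have hr3 : enorm h < r / 3%:R + r / 3%:R.
    by rewrite (le_lt_trans (ler_enormB _ x _))// (enormB x) ltrD.
  apply: (@le_trans _ _ (m%:R * (n%:R * eta * enorm h))); last first.
    rewrite !mulrA ler_wpM2r// /eta ler_pdivrMr//.
    by rewrite [leRHS]mulrDr mulr1 [leLHS]mulrC lerDl ltW.
  apply: (le_trans (ler_enorm_sumcoord _)).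
  rewrite [leRHS]mulr_natl -[X in _ *+ X]card_ord -sumr_const; apply: ler_sum => j _.
  have -> : (f y' - f y - h *m A) ord0 j =
      f (y + h) ord0 j - f y ord0 j - \sum_i h ord0 i * A i j by rewrite -y'E !mxE.
  apply: (@strict_diff_coord _ (fun z => f z ord0 j)) => q qh i.
  have /hr[Uq hq] : enorm (y + q - x) < r.
    rewrite (le_lt_trans (ler_enormB _ y _))// [y + q]addrC addrK.
    by move: yx hr3 qh; lra.
  have dq := df _ (delta_mx ord0 i) Uq; split; first exact: (derivable_mxP _ _ _).1.
  have -> : 'D_(delta_mx ord0 i) (fun z => f z ord0 j) (y + q) =
    'D_(delta_mx ord0 i) f (y + q) ord0 j by rewrite (derive_mx dq) mxE.
  rewrite mxE distrC; apply: le_trans (ltW (hq i)).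
  rewrite [leRHS]/Num.Def.normr/= mx_normrE.
  by apply: le_trans (le_bigmax _ _ (ord0, j)); rewrite /= !mxE.
exists A => // v; apply/cvg_lim => //; apply/cvgrPdist_le => e e0.
have e'0 : 0 < e / (enorm v + 1) by rewrite divr_gt0// ltr_wpDl.
have [r r0 hr] := sA _ e'0.
near=> t; have t0 : t != 0 by near: t; exact: nbhs_dnbhs_neq.
have tr : enorm (t *: v + x - x) < r.
  rewrite addrK enormZ; apply: (@le_lt_trans _ _ (`|t| * (enorm v + 1))).
    by rewrite ler_wpM2l// lerDl.
  rewrite -ltr_pdivlMr ?ltr_wpDl//; near: t; apply: dnbhs0_lt.
  by rewrite divr_gt0// ltr_wpDl.
have := hr x (t *: v + x) _ tr; rewrite subrr enorm0 addrK => /(_ r0) {}hr /=.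
rewrite distrC; apply: (le_trans (ler_norm_enorm _)).
have -> : t^-1 *: (f (t *: v + x) - f x) - v *m A =
    t^-1 *: (f (t *: v + x) - f x - (t *: v) *m A).
  by rewrite [RHS]scalerBr -scalemxAl scalerA mulVf// scale1r.
rewrite enormZ normfV ler_pdivrMl ?normr_gt0//; apply: (le_trans hr).
rewrite enormZ mulrCA ler_wpM2l// mulrAC ler_pdivrMr ?ltr_wpDl//.
by rewrite ler_wpM2l ?lerDl// ltW.
Unshelve. all: by end_near. Qed.

Lemma strict_diff_continuous n m (f : 'rV[R]_n -> 'rV[R]_m) x A :
  strict_diff f x A -> {for x, continuous f}.
Proof.
move=> /(_ 1 ltr01)[r r0 hr]; have [K K0 hK] := mulmx_bounded A.
apply: (@cvgrPdist_lt _ _ _ (nbhs x) _ f (f x)).2 => e e0; apply/nbhs_enormP.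
exists (Num.min r (e / (K + 1))); first by rewrite lt_min r0 divr_gt0// ltr_wpDl// ltW.
move=> y; rewrite lt_min => /andP[yr]; rewrite ltr_pdivlMr ?ltr_wpDl 1?ltW// => ye.
rewrite distrC; apply: le_lt_trans (ler_norm_enorm _) _.
have := hr x y; rewrite subrr enorm0 => /(_ r0 yr) {}hr.
rewrite -(subrK ((y - x) *m A) (f y - f x)).
apply: (le_lt_trans (ler_enormD _ _)); have := hK (y - x).
by move: hr ye; lra.
Qed.

(** [Ck k.+1] mentions only directional derivatives of [f]. By induction these are continuous, hence
    [f] is strictly differentiable and so continuous. *)
Lemma Ck_continuous n m k (f : 'rV[R]_n -> 'rV[R]_m) (U : set 'rV[R]_n) :
  open U -> Ck k U f -> forall x, U x -> {for x, continuous f}.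
Proof.
move=> oU; elim: k f => [//|k IH] f [df cf] x Ux.
have [A sA _] := C1_strict_diff oU Ux (fun y v => df y v) (fun v => IH _ (cf v)).
exact: strict_diff_continuous sA.
Qed.

Lemma Ck_strict_diff n m k (f : 'rV[R]_n -> 'rV[R]_m) (U : set 'rV[R]_n) x :
  open U -> Ck k.+1 U f -> U x ->
  exists2 A, strict_diff f x A & forall v, 'D_v f x = v *m A.
Proof.
move=> oU [df cf] Ux; apply: (C1_strict_diff oU Ux) => [y v Uy|v]; first exact: df.
exact: Ck_continuous (cf v).
Qed.

End StrictDifferentiability.

(** * Error bound and first-order flatness *)

Section FlatSets.
Context {R : realType}.
Implicit Types n m : nat.

(** A minimiser [w] of |f w| + c |w - z| satisfies |w - z| <= |f z| / c. If f w were nonzero, a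
    short Newton step would lower the first term more than it raises the second. The constant [K] is
    independent of the target radius [s]. *)
Lemma zero_error_bound n m (f : 'rV[R]_n -> 'rV[R]_m) x A (B : 'M[R]_(m, n)) :
  strict_diff f x A -> B *m A = 1%:M -> f x = 0 ->
  exists2 K, 0 < K & forall s, 0 < s -> exists2 r, 0 < r & forall z,
    enorm (z - x) < r -> exists w,
      [/\ enorm (w - x) < s, f w = 0 & enorm (w - z) <= K * enorm (f z)].
Proof.
move=> sf BA fx; have [KB KB0 hB] := mulmx_bounded B.
have [KA KA0 hA] := mulmx_bounded A.
(* With c KB = 1/4, a Newton step of fraction t loses at most t |f w| / 4 to linearisation and as
   much to the penalty, against a gain of t |f w|. *)
have [c c0 cKB] : exists2 c, 0 < c & c * KB = 4%:R^-1.
  exists (4%:R * KB)^-1; first by rewrite invr_gt0 mulr_gt0.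
  by rewrite invfM -mulrA mulVf ?gt_eqF// mulr1.
exists c^-1; rewrite ?invr_gt0// => s s0; have [r0 r00 hr0] := sf c c0.
pose L := c + KA; have L0 : 0 < L by rewrite addr_gt0.
have lip w w' : enorm (w - x) < r0 -> enorm (w' - x) < r0 ->
    enorm (f w - f w') <= L * enorm (w - w').
  move=> wr w'r; rewrite -(subrK ((w - w') *m A) (f w - f w')) mulrDl.
  by apply: (le_trans (ler_enormD _ _)); rewrite lerD ?hA ?hr0.
pose q := Num.min s r0 / 2%:R.
have q0 : 0 < q by rewrite divr_gt0// lt_min s0.
have qs : q < s by rewrite ltr_pdivrMr// (@le_lt_trans _ _ s) ?ge_min ?lexx//; lra.
have qr : q < r0 by rewrite ltr_pdivrMr// (@le_lt_trans _ _ r0) ?ge_min ?lexx ?orbT//; lra.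
have M0 : 0 < c^-1 * L + 1 by rewrite ltr_wpDl// mulr_ge0// ltW// invr_gt0.
(* Since |w - z| <= L |z - x| / c, this radius puts the minimiser strictly inside the ball and
   leaves room for the Newton step. *)
exists (q / (c^-1 * L + 1)); first by rewrite divr_gt0.
move=> z; rewrite ltr_pdivlMr// => zq.
have zx : enorm (z - x) < q.
  by apply: le_lt_trans zq; rewrite ler_peMr// lerDr mulr_ge0// ltW// invr_gt0.
have fz : enorm (f z) <= L * enorm (z - x).
  by rewrite -[f z]subr0 -fx lip ?subrr ?enorm0// (lt_trans zx).
have [||||w wx wmin] := @lipschitz_min _ _ [set w | enorm (w - x) <= q]
  (fun w => enorm (f w) + c * enorm (w - z)) x q (L + c).
- by exists x; rewrite /= subrr enorm0 ltW.
- exact: closed_enorm_ball.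
- by [].
- move=> w w' /= wq w'q.
  have := lip _ _ (le_lt_trans wq qr) (le_lt_trans w'q qr).
  have := ler_enormB w w' z; have := ler_enormD (f w - f w') (f w'); rewrite subrK.
  by nra.
have cwz : enorm (f w) + c * enorm (w - z) <= enorm (f z).
  by have := wmin z (ltW zx); rewrite subrr enorm0 mulr0 addr0.
have wz : enorm (w - z) <= c^-1 * enorm (f z).
  by rewrite ler_pdivlMl//; apply: le_trans cwz; rewrite lerDr.
have wq : enorm (w - x) < q.
  apply: le_lt_trans (ler_enormB _ z _) _; apply: le_lt_trans zq.
  rewrite mulrDr mulr1 lerD2r (le_trans wz)// mulrCA ler_pM2l ?invr_gt0//.
  by rewrite mulrC.
exists w; split => //; first exact: lt_trans qs.
apply: enorm_eq0; apply/eqP; apply/negPn/negP => fw0.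
set a := enorm (f w) in fw0 cwz.
have a0 : 0 < a by rewrite lt_neqAle eq_sym fw0 /a enorm_ge0.
(* a Newton step of small length [t] would decrease the minimised function *)
pose t := Num.min 1 ((q - enorm (w - x)) / (KB * a)).
have t0 : 0 < t by rewrite lt_min ltr01 divr_gt0 ?mulr_gt0// subr_gt0.
have t1 : t <= 1 by rewrite ge_min lexx.
have tq : t * (KB * a) <= q - enorm (w - x).
  by rewrite -ler_pdivlMr ?mulr_gt0//; by rewrite ge_min lexx orbT.
pose h := - t *: (f w *m B).
have hle : enorm h <= t * (KB * a).
  by rewrite enormZ normrN gtr0_norm// ler_wpM2l ?hB// ltW.
have whq : enorm (w + h - x) <= q.
  by rewrite addrAC (le_trans (ler_enormD _ _))//; lra.
have := wmin _ whq; apply/negP; rewrite -ltNge.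
have hAE : h *m A = - t *: f w by rewrite -scalemxAl -mulmxA BA mulmx1.
have h1 : enorm (f (w + h)) <= (1 - t) * a + c * enorm h.
  have -> : f (w + h) = (1 - t) *: f w + (f (w + h) - f w - (w + h - w) *m A).
    rewrite [w + h]addrC addrK hAE scalerBl scale1r scaleNr opprK.
    by rewrite [RHS]addrC [RHS]addrACA subrK subrr addr0.
  apply: (le_trans (ler_enormD _ _)); apply: lerD.
    by rewrite enormZ ger0_norm ?subr_ge0.
  have := hr0 w (w + h); rewrite [w + h]addrC addrK [h + w]addrC; apply.
    exact: lt_trans qr.
  exact: le_lt_trans qr.
have h2 : enorm (w + h - z) <= enorm (w - z) + enorm h by rewrite addrAC ler_enormD.
have ch : c * enorm h <= t * a / 4%:R.
  have -> : t * a / 4%:R = c * (t * (KB * a)) by rewrite -cKB; ring.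
  by rewrite ler_pM2l.
have ta : 0 < t * a by rewrite mulr_gt0.
have := ler_wpM2l (ltW c0) h2; rewrite -/a.
by move: h1 ch ta; lra.
Qed.

(** One matrix [P] serves all base points near [x]. The corrected point [z] need be neither unique
    nor continuous in the data. *)
Definition flat_at n (C : set 'rV[R]_n) x (P : 'M[R]_n) :=
  forall e, 0 < e -> exists2 r, 0 < r &
    (forall y p, C y -> C p -> enorm (y - x) < r -> enorm (p - x) < r ->
       enorm ((y - p) - (y - p) *m P) <= e * enorm (y - p)) /\
    (forall y v, C y -> enorm (y - x) < r -> enorm v < r -> v *m P = v ->
       exists2 z, C z & enorm (z - (y + v)) <= e * enorm v).

(** With 1 - P = AB, chords between zeros of [F] have small image under [A], hence a small normal
    part. For a tangent step, F (y + v) = o(|v|) because vA = 0, and the error bound supplies a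
    nearby zero. *)
Lemma ck_manifold_flat n k (C : set 'rV[R]_n) x : (0 < k)%N ->
  ck_manifold_around k C x -> exists2 P, orthoproj P & flat_at C x P.
Proof.
case: k => // k _ [Cx [U [m [F [oU [Ux [ckF [CU surj]]]]]]]].
have [A sA DA] := Ck_strict_diff oU ckF Ux.
have CF y : U y -> C y -> F y = 0.
  by move=> Uy Cy; have [] : [set x | U x /\ F x = 0] y by rewrite -CU.
have FC y : U y -> F y = 0 -> C y.
  by move=> Uy Fy; have [] : (C `&` U) y by rewrite CU.
have [|B [P [BA PE oP kerP]]] := @orthoproj_kernel _ _ _ A.
  by move=> w; have [v] := surj x Cx Ux w; rewrite DA => vA; exists v.
exists P => // e e0; have [KB KB0 hB] := mulmx_bounded B.
have [K K0 hK] := zero_error_bound sA BA (CF _ Ux Cx).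
have /nbhs_enormP[u u0 hu] : nbhs x U by exact: open_nbhs_nbhs.
(* Asking for zeros within [u] of [x] keeps them in [U], where a zero of [F] is a point of [C]. *)
have [s s0 hs] := hK _ u0.
have eKB : 0 < e / KB by rewrite divr_gt0.
have eK : 0 < e / K by rewrite divr_gt0.
have [r1 r10 h1] := sA _ eKB; have [r2 r20 h2] := sA _ eK.
pose r := Num.min (Num.min u s) (Num.min r1 r2) / 2%:R.
have r0 : 0 < r by rewrite divr_gt0// !lt_min u0 s0 r10.
have rr : r + r <= Num.min (Num.min u s) (Num.min r1 r2).
  by rewrite /r; move: (Num.min _ _) => a; lra.
move: rr; rewrite !le_min => /andP[/andP[ru rs] /andP[rr1 rr2]].
exists r => //; split => [y p Cy Cp yr pr|y v Cy yr vr vP].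
  have Fy : F y = 0 by apply: CF => //; apply: hu; lra.
  have Fp : F p = 0 by apply: CF => //; apply: hu; lra.
  have -> : (y - p) - (y - p) *m P = (y - p) *m A *m B.
    by rewrite PE mulmxBr mulmx1 subKr mulmxA.
  apply: (le_trans (hB _)); rewrite mulrC -ler_pdivlMr// mulrAC.
  by have := h1 p y; rewrite Fy Fp subrr add0r enormN; apply; lra.
have vA : v *m A = 0 by apply/kerP.
have Fy : F y = 0 by apply: CF => //; apply: hu; lra.
have yvr : enorm (y + v - x) < r + r.
  by rewrite addrAC (le_lt_trans (ler_enormD _ _))// ltrD.
have [|w [wu Fw wle]] := hs (y + v); first exact: lt_le_trans rs.
exists w; first by apply: FC => //; exact: hu.
apply: (le_trans wle); rewrite mulrC -ler_pdivlMr// mulrAC.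
have := h2 y (y + v); rewrite [y + v]addrC addrK [v + y]addrC vA Fy !subr0; apply; lra.
Qed.

End FlatSets.

(** * Tangent spaces and projections onto flat sets *)

Section Projections.
Context {R : realType}.
Implicit Types n m : nat.

Lemma le0_small (a b : R) : (forall e, 0 < e -> e <= 1 -> a <= e * b) -> a <= 0.
Proof.
move=> h; have [b0|b0] := leP b 0.
  by apply: (le_trans (h 1 ltr01 (lexx _))); rewrite mul1r.
rewrite leNgt; apply/negP => a0.
have m0 : 0 < Num.min 1 (a / 2%:R / b) by rewrite lt_min ltr01 !divr_gt0.
have : Num.min 1 (a / 2%:R / b) * b <= a / 2%:R.
  by rewrite -ler_pdivlMr// ge_min lexx orbT.
have := h _ m0; rewrite ge_min lexx => /(_ isT); lra.
Qed.

(** Derivatives of curves are limits of chords, which are nearly in the range of [P]. Conversely,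
    nearest points in [C] to x + tv form a curve with derivative [v] at 0, since correctable tangent
    steps bound the distance by o(t). *)
Lemma flat_tangent n (C : set 'rV[R]_n) x P : closed C -> C x -> orthoproj P ->
  flat_at C x P -> forall v, tangent C x v <-> v *m P = v.
Proof.
move=> cC Cx oP fC v; split.
  move=> [c [c0 [Cc [dc Dc]]]].
  have cvgv : (fun h : R => h^-1 *: ((c \o shift 0) (h *: 1) - c 0)) @ 0^' --> v.
    by rewrite -Dc; exact: dc.
  suff : enorm (v - v *m P) <= 0.
    move=> h; apply/esym/eqP; rewrite -subr_eq0; apply/eqP/enorm_eq0/eqP.
    by rewrite eq_le h enorm_ge0.
  (* For a difference quotient w within e of v: |v - w| and |wP - vP| cost e each, and |w - wP| <= e
     |w| <= e (1 + |v|). *)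
  apply: (@le0_small _ (3%:R + enorm v)) => e e0 e1.
  have [r r0 [hr _]] := fC e e0.
  have ev : 0 < e + enorm v by rewrite ltr_pwDl.
  have nv : nbhs v [set w | enorm (w - v) < e] by apply/nbhs_enormP; exists e.
  near (0 : R)^' => t.
  have t0 : t != 0 by near: t; exact: nbhs_dnbhs_neq.
  have Ct : C (c t) by near: t; exact: nbhs_dnbhs.
  have tr : `|t| < r / (e + enorm v) by near: t; apply: dnbhs0_lt; rewrite divr_gt0.
  have : enorm (t^-1 *: ((c \o shift 0) (t *: 1) - c 0) - v) < e.
    by near: t; exact: cvgv nv.
  rewrite /= [t *: 1]mulr1 addr0 c0; set w := t^-1 *: (c t - x) => wv.
  have ctE : c t - x = t *: w by rewrite scalerA mulfV// scale1r.
  move: w wv ctE => w wv ctE.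
  have wle : enorm w <= e + enorm v.
    by rewrite -(subrK v w) (le_trans (ler_enormD _ _))// lerD2r ltW.
  have := hr (c t) x Ct Cx; rewrite subrr enorm0 ctE enormZ => /(_ _ r0) hw.
  have {hw} : enorm (w - w *m P) <= e * enorm w.
    have := hw; rewrite -scalemxAl -scalerBr enormZ mulrCA ler_pM2l ?normr_gt0//.
    apply; apply: le_lt_trans (ler_wpM2l (normr_ge0 _) wle) _.
    by rewrite -ltr_pdivlMr.
  have := ler_enormB v w (v *m P); have := ler_enormB w (w *m P) (v *m P).
  have := orthoproj_le (w - v) oP; rewrite mulmxBl (enormB v w).
  have : e * enorm w <= e * (1 + enorm v).
    by apply: (ler_wpM2l (ltW e0)); apply: (le_trans wle); rewrite lerD2r.
  by lra.
move=> vP.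
have [c hc] := choice (fun t : R => nearest_point (x + t *: v) cC (ex_intro _ x Cx)).
have c0 : c 0 = x.
  have [_ /(_ x Cx)] := hc 0; rewrite scale0r addr0 subrr enorm0 => h.
  apply/esym/eqP; rewrite -subr_eq0; apply/eqP/enorm_eq0/eqP.
  by rewrite eq_le h enorm_ge0.
exists c; split => //; split; first exact: (@filterE _ (nbhs (0 : R)) _ _ (fun t => (hc t).1)).
suff H : (fun h : R => h^-1 *: ((c \o shift 0) (h *: 1) - c 0)) @ 0^' --> v.
  by split; [apply/cvg_ex; exists v|apply/cvg_lim].
have v1 : 0 < enorm v + 1 by rewrite ltr_wpDl.
apply/cvgrPdist_le => e e0.
have e'0 : 0 < e / (enorm v + 1) by rewrite divr_gt0.
have [r r0 [_ hr]] := fC _ e'0.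
near=> t; have t0 : t != 0 by near: t; exact: nbhs_dnbhs_neq.
have tr : `|t| < r / (enorm v + 1) by near: t; apply: dnbhs0_lt; rewrite divr_gt0.
rewrite /= [t *: 1]mulr1 addr0 c0; apply: (le_trans (ler_norm_enorm _)).
have [|||z Cz zle] := hr x (t *: v) Cx.
- by rewrite subrr enorm0.
- rewrite enormZ; apply: (@le_lt_trans _ _ (`|t| * (enorm v + 1))).
    by rewrite ler_wpM2l// lerDl.
  by rewrite -ltr_pdivlMr.
- by rewrite -scalemxAl vP.
have [_ /(_ z Cz)] := hc t; rewrite (enormB (x + t *: v) z) => /le_trans/(_ zle).
have -> : v - t^-1 *: (c t - x) = t^-1 *: (x + t *: v - c t).
  by rewrite addrAC [RHS]scalerDr scalerA mulVf// scale1r [RHS]addrC -[x - c t]opprB scalerN.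
move=> h; rewrite enormZ normfV ler_pdivrMl ?normr_gt0//; apply: (le_trans h).
rewrite enormZ mulrCA ler_wpM2l// mulrAC ler_pdivrMr//.
by rewrite ler_wpM2l ?lerDl// ltW.
Unshelve. all: by end_near. Qed.

(** If z - y had a sizeable tangential part [u], moving from [y] by a fraction of [u] and correcting
    back into [C] would come closer to [z] than the nearest point [y]. *)
Lemma flat_proj_normal n (C : set 'rV[R]_n) x P : orthoproj P -> flat_at C x P ->
  forall e, 0 < e -> exists2 r, 0 < r & forall z y,
    enorm (z - x) < r -> enorm (y - x) < r -> is_proj C z y ->
    enorm ((z - y) *m P) <= e * enorm (z - y).
Proof.
(* The same [t] is the fraction of [u] travelled and the accuracy of the correction, so the
   correction costs only t^2 |u|. *)
move=> oP fC e e0; pose t := Num.min 1 (e / 2%:R).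
have t0 : 0 < t by rewrite lt_min ltr01 divr_gt0.
have t1 : t <= 1 by rewrite ge_min lexx.
have te : t <= e / 2%:R by rewrite ge_min lexx orbT.
have [r r0 [_ hr]] := fC t t0; exists (r / 2%:R); first by rewrite divr_gt0.
move=> z y zr yr [Cy ymin].
have := orthoproj_le (z - y) oP; have := orthoproj_enorm (z - y) oP.
have := orthoproj_pythagoras (z - y) (1 - t) 1 oP.
set u := (z - y) *m P; have -> : (1 - t) *: u + 1 *: (z - y - u) = z - (y + t *: u).
  by rewrite scalerBl !scale1r opprD [RHS]addrA [LHS]addrC addrA subrK.
rewrite expr1n mul1r => pyt nrm ub.
have tub : enorm (t *: u) <= t * enorm u by rewrite enormZ gtr0_norm.
have zyr : enorm (z - y) < r.
  by apply: le_lt_trans (ler_enormB _ x _) _; rewrite (enormB x); lra.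
have [|||w Cw wle] := hr y (t *: u) Cy.
- by lra.
- by apply: le_lt_trans zyr; apply: (le_trans tub); have := enorm_ge0 u; nra.
- by have [_ PP] := oP; rewrite -scalemxAl /u -mulmxA PP.
have {Cw} := ymin w Cw; have := ler_enormB z (y + t *: u) w.
rewrite (enormB (y + t *: u) w) => h1 h2.
have h3 : enorm (z - y) - t * (t * enorm u) <= enorm (z - (y + t *: u)).
  by have := ler_wpM2l (ltW t0) tub; lra.
have {h1 h2 wle} := h3; move: pyt nrm ub; set a := enorm (z - y).
set b := enorm u; set d := enorm (z - y - u); set g := enorm (z - _).
move=> pyt nrm ub {}h3.
have a0 : 0 <= a by exact: enorm_ge0. have b0 : 0 <= b by exact: enorm_ge0.
have [bE|bn0] := eqVneq b 0; first by rewrite bE mulr_ge0// ltW.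
have bp : 0 < b by rewrite lt_neqAle eq_sym bn0.
(* Squaring is licit because t^2 b <= b <= a. *)
have h4 : (a - t * (t * b)) ^+ 2 <= g ^+ 2.
  rewrite ler_pXn2r ?nnegrE ?enorm_ge0// subr_ge0.
  have : t * (t * b) <= 1 * (1 * b) by rewrite !ler_pM// ?mulr_ge0// ltW.
  by lra.
have h5 : t * b * (2%:R * b - t * b - 2%:R * t * a) <= 0.
  have : 0 <= (t * (t * b)) ^+ 2 by exact: sqr_ge0.
  by move: h4 pyt nrm; lra.
(* What remains is 2b <= tb + 2ta <= 3ta, and t <= e/2 finishes. *)
rewrite pmulr_rle0 ?mulr_gt0// in h5.
have : t * b <= t * a by rewrite ler_pM2l.
have : t * a <= e / 2%:R * a by rewrite ler_wpM2r.
by lra.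
Qed.

End Projections.

(** * First-order expansions of one step *)

Section Expansions.
Context {R : realType}.
Implicit Types n m : nat.

(** [T] is a relation because projections may be set-valued. Points [p] of [D] act as fixed points
    of [T], and the error is measured against |z - p|, uniformly in [p]. *)
Definition expands n (T : 'rV[R]_n -> 'rV[R]_n -> Prop) (D : set 'rV[R]_n) x (L : 'M[R]_n) :=
  forall e, 0 < e -> exists2 r, 0 < r & forall z z' p, T z z' -> D p ->
    enorm (z - x) < r -> enorm (p - x) < r ->
    enorm (z' - p - (z - p) *m L) <= e * enorm (z - p).

Lemma expands_proj n (C D : set 'rV[R]_n) x P : orthoproj P -> flat_at C x P ->
  C x -> D `<=` C -> expands (is_proj C) D x P.
Proof.
(* The chord y - p costs two thirds of [e], as |y - p| <= 2 |z - p|; the residual z - y costs one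
   third. *)
move=> oP fC Cx DC e e0; have e30 : 0 < e / 3%:R by rewrite divr_gt0.
have [r1 r10 [h1 _]] := fC _ e30; have [r2 r20 h2] := flat_proj_normal oP fC e30.
exists (Num.min r1 r2 / 2%:R); first by rewrite divr_gt0// lt_min r10.
have m1 : Num.min r1 r2 <= r1 by rewrite ge_min lexx.
have m2 : Num.min r1 r2 <= r2 by rewrite ge_min lexx orbT.
have m0 : 0 < Num.min r1 r2 by rewrite lt_min r10.
move: (Num.min r1 r2) m0 m1 m2 => r r0 m1 m2 z y p prj /DC Cp zr pr.
have [Cy ymin] := prj; have yzx := ymin x Cx; have yzp := ymin p Cp.
have yr : enorm (y - x) < r.
  by apply: le_lt_trans (ler_enormB _ z _) _; rewrite (enormB y); lra.
have {}h1 : enorm (y - p - (y - p) *m P) <= e / 3%:R * enorm (y - p).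
  by apply: h1 => //; lra.
have {}h2 : enorm ((z - y) *m P) <= e / 3%:R * enorm (z - y).
  by apply: h2 => //; lra.
have -> : y - p - (z - p) *m P = (y - p - (y - p) *m P) - (z - y) *m P.
  have -> : (z - p) *m P = (z - y) *m P + (y - p) *m P.
    by rewrite -mulmxDl addrA subrK.
  by rewrite opprD addrA [LHS]addrAC.
have yp : enorm (y - p) <= 2%:R * enorm (z - p).
  by apply: (le_trans (ler_enormB _ z _)); rewrite (enormB y); lra.
apply: (le_trans (ler_enormD _ _)); rewrite enormN.
have := ler_wpM2l (ltW e30) yp; have := ler_wpM2l (ltW e30) yzp.
by lra.
Qed.

Lemma expands_relax n (T : 'rV[R]_n -> 'rV[R]_n -> Prop) D x L a : expands T D x L ->
  expands (fun z z' => exists2 y, T z y & z' = (1 - a) *: z + a *: y) D x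
    ((1 - a) *: 1%:M + a *: L).
Proof.
move=> eT e e0; have a1 : 0 < `|a| + 1 by rewrite ltr_wpDl.
have [|r r0 hr] := eT (e / (`|a| + 1)); first by rewrite divr_gt0.
exists r => // z _ p [y Ty ->] Dp zr pr.
have -> : (1 - a) *: z + a *: y - p - (z - p) *m ((1 - a) *: 1%:M + a *: L) =
    a *: (y - p - (z - p) *m L).
  rewrite mulmxDr -!scalemxAr mulmx1; set w := (z - p) *m L.
  by apply/rowP => i; rewrite !mxE; ring.
rewrite enormZ; apply: (le_trans (ler_wpM2l (normr_ge0 _) (hr _ _ _ Ty Dp zr pr))).
rewrite mulrA ler_wpM2r// mulrA ler_pdivrMr// mulrC ler_wpM2l ?lerDl//.
exact: ltW.
Qed.

Lemma expands_comp n (T1 T2 : 'rV[R]_n -> 'rV[R]_n -> Prop) D x L1 L2 :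
  expands T1 D x L1 -> expands T2 D x L2 ->
  expands (fun z z' => exists2 y, T1 z y & T2 y z') D x (L1 *m L2).
Proof.
move=> eT1 eT2 e e0; have [K1 K10 hK1] := mulmx_bounded L1.
have [K2 K20 hK2] := mulmx_bounded L2.
have K11 : 0 < K1 + 1 by rewrite ltr_wpDl// ltW.
have [|r2 r20 h2] := eT2 (e / 2%:R / (K1 + 1)); first by rewrite !divr_gt0.
(* The bound 1 gives |y - p| <= (K1 + 1) |z - p|; the other bound makes the first error, once
   multiplied by [L2], at most half of [e]. *)
pose e1 := Num.min 1 (e / 2%:R / K2).
have e11 : e1 <= 1 by rewrite ge_min lexx.
have e1K : K2 * e1 <= e / 2%:R by rewrite mulrC -ler_pdivlMr// ge_min lexx orbT.
have [|r1 r10 h1] := eT1 e1; first by rewrite lt_min ltr01 !divr_gt0.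
have K13 : 0 < 2%:R * K1 + 3%:R by lra.
(* |y - x| <= (K1 + 1)(|z - x| + |p - x|) + |p - x|, whence the factor 2 K1 + 3. *)
exists (Num.min r1 (r2 / (2%:R * K1 + 3%:R))); first by rewrite lt_min r10 divr_gt0.
move=> z w p [y T1y T2y] Dp; rewrite !lt_min !ltr_pdivlMr//.
move=> /andP[zr1 zr2] /andP[pr1 pr2].
have {}h1 := h1 _ _ _ T1y Dp zr1 pr1.
have zp : enorm (z - p) <= enorm (z - x) + enorm (p - x).
  by apply: (le_trans (ler_enormB _ x _)); rewrite (enormB x).
have yp : enorm (y - p) <= (K1 + 1) * enorm (z - p).
  rewrite -(subrK ((z - p) *m L1) (y - p)); apply: (le_trans (ler_enormD _ _)).
  have := ler_wpM2r (enorm_ge0 (z - p)) e11; have := hK1 (z - p).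
  by move: h1; lra.
have yx : enorm (y - x) < r2.
  apply: (le_lt_trans (ler_enormB _ p _)).
  have := enorm_ge0 (z - x); have := enorm_ge0 (p - x).
  by have := ler_wpM2l (ltW K11) zp; move: yp zr2 pr2; nra.
have px : enorm (p - x) < r2.
  by have := enorm_ge0 (p - x); move: pr2; nra.
have {}h2 := h2 _ _ _ T2y Dp yx px.
have -> : w - p - (z - p) *m (L1 *m L2) =
    (w - p - (y - p) *m L2) + (y - p - (z - p) *m L1) *m L2.
  by rewrite [X in _ = _ + X]mulmxBl addrA subrK mulmxA.
apply: (le_trans (ler_enormD _ _)); have := hK2 (y - p - (z - p) *m L1).
have := ler_wpM2l (ltW K20) h1; have := ler_wpM2r (enorm_ge0 (z - p)) e1K.
have : e / 2%:R / (K1 + 1) * enorm (y - p) <= e / 2%:R * enorm (z - p).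
  rewrite mulrAC ler_pdivrMr// -[leRHS]mulrA; apply: ler_wpM2l; first by rewrite divr_ge0// ltW.
  by rewrite mulrC.
by move: h2; lra.
Qed.

Lemma expands_iter n (T : 'rV[R]_n -> 'rV[R]_n -> Prop) D x L m : expands T D x L ->
  expands (fun z z' => exists u : nat -> 'rV[R]_n,
    [/\ u 0%N = z, u m = z' & forall j, T (u j) (u j.+1)]) D x (L ^+ m).
Proof.
move=> eT; elim: m => [|m IH] e e0.
  exists 1 => // z _ p [u [-> <- _]] _ _ _.
  by rewrite expr0 mulmx1 subrr enorm0 mulr_ge0// ltW.
have [r r0 hr] := expands_comp IH eT e0; exists r => // z z' p [u [uz uz' Tu]].
by rewrite exprSr; apply: hr; exists (u m); [exists u|rewrite -uz'].
Qed.

(** Matrices act on rows, so the factor of [N], applied first, stands on the left in [S_T_mx]. *)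
Lemma expands_S_step n (M N D : set 'rV[R]_n) x PM PN al al1 al2 :
  M x -> N x -> D `<=` M -> D `<=` N ->
  orthoproj PM -> flat_at M x PM -> orthoproj PN -> flat_at N x PN ->
  expands (S_step M N al al1 al2) D x (S_T_mx PM PN al al1 al2).
Proof.
move=> Mx Nx DM DN oM fM oN fN e e0.
have eN := expands_relax al1 (expands_proj oN fN Nx DN).
have eM := expands_relax al2 (expands_proj oM fM Mx DM).
have [r r0 hr] := expands_relax al (expands_comp eN eM) e0.
exists r => // z z' p [y1 [y2 [p1 [p2 ->]]]]; apply: hr.
eexists; last reflexivity.
by exists ((1 - al1) *: z + al1 *: y1); [exists y1|exists y2].
Qed.

End Expansions.

(** * Eigenvalues and powers of a matrix *)

Section Spectral.
Context {R : realType}.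
Implicit Types n m : nat.

Import ComplexField.Normc.

(** The supremum is meaningful because moduli of eigenvalues are bounded: |uA|^2 + |vA|^2 = (c^2 +
    d^2)(|u|^2 + |v|^2) for an eigenvector u + iv with eigenvalue c + id. *)
Lemma gamma_ub n (A : 'M[R]_n) a b : is_eigenvalue A a b -> (a, b) <> (1, 0) ->
  Num.sqrt (a ^+ 2 + b ^+ 2) <= gamma A.
Proof.
move=> eig ab1; apply: ub_le_sup; last by right; exists (a, b).
have [K K0 hK] := mulmx_bounded A.
exists K => _ [->|[[c d] /= [[u [v [uv [uA vA]]]] _] <-]]; first exact: ltW.
rewrite -(ler_pXn2r (n := 2)) ?nnegrE ?sqrtr_ge0 ?(ltW K0)// sqr_sqrtr ?addr_ge0 ?sqr_ge0//.
have uv0 : 0 < enorm u ^+ 2 + enorm v ^+ 2.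
  have nz (w : 'rV[R]_n) : w != 0 -> 0 < enorm w ^+ 2.
    move=> w0; rewrite exprn_gt0// lt_neqAle enorm_ge0 andbT eq_sym.
    by apply: contra w0 => /eqP/enorm_eq0 ->.
  by case: uv => /nz h; [apply: ltr_pwDl|apply: ltr_wpDl]; rewrite ?sqr_ge0.
rewrite -(ler_pM2r uv0).
have -> : (c ^+ 2 + d ^+ 2) * (enorm u ^+ 2 + enorm v ^+ 2) =
    enorm (u *m A) ^+ 2 + enorm (v *m A) ^+ 2.
  by rewrite uA vA !sqr_enorm !dotE (dotC v u); ring.
rewrite mulrDr -!exprMn; by apply: lerD; rewrite ler_pXn2r ?nnegrE ?mulr_ge0 ?(ltW K0)//.
Qed.

Lemma gamma_ge0 n (A : 'M[R]_n) : 0 <= gamma A.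
Proof.
have [[[a b] /= [eig ab]]|h] := pselect (exists ab, is_eigenvalue A ab.1 ab.2 /\ ab <> (1, 0)).
  exact: le_trans (sqrtr_ge0 _) (gamma_ub eig ab).
rewrite /gamma (_ : _ `|` _ = [set 0]) ?sup1//.
apply/seteqP; split => [x [//|[ab hab _]]|x ->]; last by left.
by case: h; exists ab.
Qed.

Lemma Re_sum (I : finType) (F : I -> R[i]) : complex.Re (\sum_i F i) = \sum_i complex.Re (F i).
Proof. by apply: big_morph => [[a b] [c d]|]; reflexivity. Qed.

Lemma Im_sum (I : finType) (F : I -> R[i]) : complex.Im (\sum_i F i) = \sum_i complex.Im (F i).
Proof. by apply: big_morph => [[a b] [c d]|]; reflexivity. Qed.

Lemma eigenvalue_complex n (A : 'M[R]_n) (z : R[i]) :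
  eigenvalue (map_mx (real_complex R) A) z -> is_eigenvalue A (complex.Re z) (complex.Im z).
Proof.
move=> /eigenvalueP[w wA w0]; exists (map_mx (@complex.Re R) w), (map_mx (@complex.Im R) w); split.
  apply/orP; rewrite -negb_and; apply: contra w0 => /andP[/eqP u0 /eqP v0].
  apply/eqP/rowP => j; move/rowP: u0 => /(_ j); move/rowP: v0 => /(_ j).
  by rewrite !mxE; case: (w _ _) => a b /= -> ->.
split; apply/rowP => j; move/rowP: wA => /(_ j); rewrite !mxE.
  move/(congr1 (@complex.Re R)); rewrite Re_sum; under eq_bigr do rewrite mxE.
  under [in X in _ -> X]eq_bigr do rewrite mxE.
  case: z => a b; case: (w 0 j) => c d /= <-; apply: eq_bigr => i _.
  by case: (w 0 i) => ? ? /=; rewrite mulr0 subr0.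
move/(congr1 (@complex.Im R)); rewrite Im_sum; under eq_bigr do rewrite mxE.
under [in X in _ -> X]eq_bigr do rewrite mxE.
case: z => a b; case: (w 0 j) => c d /=; rewrite addrC => <-; apply: eq_bigr => i _.
by case: (w 0 i) => ? ? /=; rewrite mulr0 add0r.
Qed.

(* Peel off one linear factor at a time: each one turns a bound [C rho^m] into
   a linear recurrence with ratio [normc z < rho]. *)
Lemma annihilated_powers_bound n (A D : 'M[R[i]]_n.+1) (s : seq R[i]) (rho : R) :
  0 < rho -> (forall z, z \in s -> normc z < rho) ->
  D * horner_mx A (\prod_(z <- s) ('X - z%:P)) = 0 ->
  exists2 C, 0 <= C & forall m i j, normc ((D * A ^+ m) i j) <= C * rho ^+ m.
Proof.
move=> rho0; elim: s D => [|z s IH] D hs.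
  rewrite big_nil rmorph1 mulr1 => ->; exists 0 => // m i j.
  by rewrite mul0r mxE normc0 mul0r.
rewrite big_cons rmorphM rmorphB /= horner_mx_X horner_mx_C mulrA => hD.
(* The induction hypothesis is applied to D (A - z) in place of [D]. *)
have [|C C0 hC] := IH _ _ hD; first by move=> y ys; apply: hs; rewrite in_cons ys orbT.
have zr : 0 < rho - normc z by rewrite subr_gt0 hs// mem_head.
have nc0 (y : R[i]) : 0 <= normc y by case: y => a b; exact: sqrtr_ge0.
pose S := \sum_i \sum_j normc (D i j).
have S0 : 0 <= S by do 2![apply: sumr_ge0 => ? _].
have SD i j : normc (D i j) <= S.
  rewrite /S (bigD1 i)//= (bigD1 j)//= -addrA lerDl addr_ge0//.
    exact: sumr_ge0.
  by do 2![apply: sumr_ge0 => ? _].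
have Cz : 0 <= C / (rho - normc z) by rewrite divr_ge0// ltW.
(* This constant K satisfies C + |z| K <= K rho, which closes the recurrence; the summand [S] covers
   m = 0. *)
exists (S + C / (rho - normc z)); first by rewrite addr_ge0.
move=> m i j; elim: m => [|m IHm].
  by rewrite expr0 mulr1 mulr1 (le_trans (SD i j))// lerDl.
have -> : (D * A ^+ m.+1) i j = (D * (A - z%:M) * A ^+ m) i j + z * (D * A ^+ m) i j.
  have -> : D * A ^+ m.+1 = D * (A - z%:M) * A ^+ m + z *: (D * A ^+ m).
    rewrite exprS mulrA mulrBr mulrBl.
    have -> : D * z%:M = z *: D by rewrite -[D * _]/(D *m _) mul_mx_scalar.
    by rewrite -scalerAl subrK.
  by rewrite [LHS]mxE [X in _ + X = _]mxE.
apply: (le_trans (le_normcD _ _)); rewrite normcM.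
apply: (le_trans (lerD (hC _ _ _) (ler_wpM2l (nc0 _) IHm))).
rewrite exprS; set q := rho ^+ m.
have q0 : 0 <= q by rewrite exprn_ge0// ltW.
have -> : (S + C / (rho - normc z)) * (rho * q) =
  C * q + normc z * ((S + C / (rho - normc z)) * q) + S * (rho - normc z) * q.
  by field; rewrite gt_eqF.
by rewrite lerDl !mulr_ge0// ltW.
Qed.

(** The characteristic polynomial splits over [R[i]] and annihilates the matrix, so the preceding
    bound applies with D = 1; the factor n^2 passes from entries to the norm. *)
Lemma power_bound n (A : 'M[R]_n) (rho : R) : 0 < rho ->
  (forall a b, is_eigenvalue A a b -> Num.sqrt (a ^+ 2 + b ^+ 2) < rho) ->
  exists2 C, 0 < C & forall m (v : 'rV[R]_n), enorm (v *m A ^+ m) <= C * rho ^+ m * enorm v.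
Proof.
move=> rho0; case: n A => [|n] A eig.
  by exists 1 => // m v; rewrite [v]thinmx0 mul0mx enorm0 mulr0.
pose Ac := map_mx (real_complex R) A.
have [s sE] := closed_field_poly_normal (char_poly Ac).
move: sE; rewrite (monicP (char_poly_monic _)) scale1r => sE.
have hs z : z \in s -> normc z < rho.
  move=> zs; have : eigenvalue Ac z by rewrite eigenvalue_root_char sE root_prod_XsubC.
  by move/eigenvalue_complex/eig; case: z zs.
have := @annihilated_powers_bound _ Ac 1 s rho rho0 hs.
rewrite -sE Cayley_Hamilton mulr0 => /(_ erefl)[C C0 hC].
have {}hC m i j : `|(A ^+ m) i j| <= C * rho ^+ m.
  have := hC m i j; rewrite mul1r /Ac -(rmorphXn (map_mx (real_complex R))) mxE /=.
  by rewrite expr0n addr0 sqrtr_sqr.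
exists (n.+1%:R * n.+1%:R * C + 1); first by rewrite ltr_wpDl// !mulr_ge0.
move=> m v; set q := rho ^+ m; have q0 : 0 <= q by rewrite exprn_ge0// ltW.
rewrite !mulrDl mul1r; apply: ler_wpDr; first by rewrite mulr_ge0.
rewrite {1}(row_sum_delta v) mulmx_suml; apply: (le_trans (ler_enorm_sum _ _ _)).
have -> : n.+1%:R * n.+1%:R * C * q * enorm v =
    \sum_(i < n.+1) (enorm v * \sum_(j < n.+1) (C * q)).
  rewrite !sumr_const !card_ord -[RHS]mulr_natl -[(C * q) *+ _]mulr_natl.
  by move: (n.+1%:R) (enorm v) => N e; ring.
apply: ler_sum => i _; rewrite -scalemxAl -rowE enormZ ler_pM ?ler_coord_enorm//.
apply: (le_trans (ler_enorm_sumcoord _)); apply: ler_sum => j _.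
by rewrite mxE.
Qed.

End Spectral.

(** * The linearised operator *)

Section LinearizedOperator.
Context {R : realType}.
Implicit Types n m : nat.

Lemma orthoproj_fix_enorm n (P : 'M[R]_n) (v : 'rV[R]_n) : enorm (v - v *m P) ^+ 2 <= 0 ->
  v *m P = v.
Proof.
move=> h; apply/esym/eqP; rewrite -subr_eq0; apply/eqP/enorm_eq0/eqP.
by rewrite -sqrf_eq0 eq_le h sqr_ge0.
Qed.

(** Energy identity: for 0 <= a <= 2 a relaxed projection never lengthens a vector, and strictly
    shortens those it moves when 0 < a < 2. *)
Lemma relax_enorm n (P : 'M[R]_n) (w : 'rV[R]_n) a : orthoproj P ->
  enorm (w *m ((1 - a) *: 1%:M + a *: P)) ^+ 2 =
    enorm w ^+ 2 - a * (2%:R - a) * enorm (w - w *m P) ^+ 2.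
Proof.
move=> oP; rewrite (orthoproj_enorm w oP).
have -> : w *m ((1 - a) *: 1%:M + a *: P) = 1 *: (w *m P) + (1 - a) *: (w - w *m P).
  rewrite mulmxDr -!scalemxAr mulmx1; move: (w *m P) => u.
  by apply/rowP => i; rewrite !mxE; ring.
rewrite orthoproj_pythagoras//; ring.
Qed.

(** Averaging with [al] does not change fixed vectors, so [w] survives both relaxed projections
    without loss of norm. The one with parameter other than 2 then fixes its input exactly, and the
    other follows. *)
Lemma S_T_fix n (PM PN : 'M[R]_n) al al1 al2 (w : 'rV[R]_n) :
  orthoproj PM -> orthoproj PN -> al != 0 -> 0 < al1 <= 2 -> 0 < al2 <= 2 ->
  al1 != 2 \/ al2 != 2 -> w *m S_T_mx PM PN al al1 al2 = w ->
  w *m PM = w /\ w *m PN = w.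
Proof.
move=> oM oN al0 /andP[a1 a12] /andP[a2 a22] a12ne.
set R1 := (1 - al1) *: 1%:M + al1 *: PN; set R2 := (1 - al2) *: 1%:M + al2 *: PM.
have R1E v : v *m R1 = (1 - al1) *: v + al1 *: (v *m PN).
  by rewrite mulmxDr -!scalemxAr mulmx1.
have R2E v : v *m R2 = (1 - al2) *: v + al2 *: (v *m PM).
  by rewrite mulmxDr -!scalemxAr mulmx1.
have relax_fix a (v u : 'rV[R]_n) : a != 0 -> (1 - a) *: v + a *: u = v -> u = v.
  move=> a0 h; apply/eqP; rewrite -subr_eq0 -[_ == 0]orFb -(negbTE a0) -scaler_eq0.
  have -> : a *: (u - v) = (1 - a) *: v + a *: u - v.
    by apply/rowP => i; rewrite !mxE; ring.
  by rewrite h subrr.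
rewrite /S_T_mx -/R1 -/R2 mulmxDr -!scalemxAr mulmx1 => wS.
have {}wS : w *m R1 *m R2 = w.
  by rewrite -mulmxA; exact: relax_fix wS.
have e1 := relax_enorm w al1 oN; have := relax_enorm (w *m R1) al2 oM.
rewrite -/R1 -/R2 in e1 *; rewrite wS e1 => e2.
have q1 : 0 <= al1 * (2%:R - al1) by rewrite mulr_ge0 ?subr_ge0// ltW.
have q2 : 0 <= al2 * (2%:R - al2) by rewrite mulr_ge0 ?subr_ge0// ltW.
have s1 := mulr_ge0 q1 (sqr_ge0 (enorm (w - w *m PN))).
have s2 := mulr_ge0 q2 (sqr_ge0 (enorm (w *m R1 - w *m R1 *m PM))).
case: a12ne => ne.
  have wN : w *m PN = w.
    apply: orthoproj_fix_enorm; have q1' : 0 < al1 * (2%:R - al1).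
      by rewrite mulr_gt0// subr_gt0 lt_neqAle ne.
    by rewrite -(pmulr_rle0 _ q1'); lra.
  split => //; apply: (relax_fix al2); first by rewrite gt_eqF.
  have <- : w *m R1 = w by rewrite R1E wN -scalerDl subrK scale1r.
  by rewrite -R2E wS R1E wN -scalerDl subrK scale1r.
(* Here the second projection is the strict one: it fixes [w *m R1], so this vector equals [w]. *)
have wM : w *m R1 *m PM = w *m R1.
  apply: orthoproj_fix_enorm; have q2' : 0 < al2 * (2%:R - al2).
    by rewrite mulr_gt0// subr_gt0 lt_neqAle ne.
  by rewrite -(pmulr_rle0 _ q2'); lra.
have wR1 : w *m R1 = w by rewrite -[RHS]wS R2E wM -scalerDl subrK scale1r.
by split; [rewrite -wR1|apply: (relax_fix al1); rewrite ?gt_eqF// -R1E].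
Qed.

(** * Removing the fixed space of the linearised operator *)

Section Deflation.
Context (n : nat) (PM PN Q : 'M[R]_n) (al al1 al2 : R).
Context (oM : orthoproj PM) (oN : orthoproj PN) (oQ : orthoproj Q).
Context (QP : forall v : 'rV[R]_n, v *m Q = v <-> v *m PM = v /\ v *m PN = v).
Local Notation S := (S_T_mx PM PN al al1 al2).

Lemma mulQ_proj : Q *m PM = Q /\ Q *m PN = Q.
Proof.
have [_ QQ] := oQ.
have h i : row i Q *m PM = row i Q /\ row i Q *m PN = row i Q.
  by apply/QP; rewrite -row_mul QQ.
by split; apply/row_matrixP => i; rewrite row_mul; case: (h i).
Qed.

(** Transposing [Q *m PM = Q] gives [PM *m Q = Q], and likewise for [PN]. In particular the kernel
    of [Q] is stable under [S]. *)
Lemma S_T_mulQ : S *m Q = Q.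
Proof.
have [[Mt _] [Nt _] [Qt _]] := And3 oM oN oQ.
have [QM QN] := mulQ_proj.
have MQ : PM *m Q = Q by rewrite -{1}Qt -Mt -trmx_mul QM.
have NQ : PN *m Q = Q by rewrite -{1}Qt -Nt -trmx_mul QN.
have rQ a P : P *m Q = Q -> ((1 - a) *: 1%:M + a *: P) *m Q = Q.
  by move=> PQ; rewrite mulmxDl -!scalemxAl mul1mx PQ -scalerDl subrK scale1r.
by rewrite mulmxDl -!scalemxAl mul1mx -mulmxA !rQ// -scalerDl subrK scale1r.
Qed.

Lemma S_T_pow_deflated m (w : 'rV[R]_n) : w *m Q = 0 -> w *m S ^+ m = w *m (S - Q) ^+ m.
Proof.
elim: m w => [//|m IH] w wQ; rewrite !exprS !mulmxA mulmxBr wQ subr0.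
by apply: IH; rewrite -mulmxA S_T_mulQ.
Qed.

(** Since (S - Q) Q = 0, eigenvectors for a nonzero eigenvalue lie in the kernel of [Q], where S - Q
    is [S]. The eigenvalue 1 is excluded: a fixed vector of [S] lies in the range of [Q], hence is
    0. *)
Lemma deflated_eigenvalue_le_gamma a b :
  al != 0 -> 0 < al1 <= 2 -> 0 < al2 <= 2 -> al1 != 2 \/ al2 != 2 ->
  is_eigenvalue (S - Q) a b -> Num.sqrt (a ^+ 2 + b ^+ 2) <= gamma S.
Proof.
move=> al0 h1 h2 ne [u [v [uv [uB vB]]]]; have [_ QQ] := oQ.
have BQ (w : 'rV[R]_n) : w *m (S - Q) *m Q = 0.
  by rewrite -mulmxA mulmxBl S_T_mulQ QQ subrr mulmx0.
have [ab0|ab0] := eqVneq (a ^+ 2 + b ^+ 2) 0; first by rewrite ab0 sqrtr0 gamma_ge0.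
have := BQ u; have := BQ v; rewrite uB vB mulmxDl mulmxBl -!scalemxAl => vQ uQ.
have uQ0 : u *m Q = 0.
  apply/eqP; rewrite -[_ == 0]orFb -(negbTE ab0) -scaler_eq0.
  (* This solves the real 2 x 2 system expressing (a + bi)(u + iv)Q = 0, of determinant a^2 +
     b^2. *)
  have -> : (a ^+ 2 + b ^+ 2) *: (u *m Q) =
      a *: (a *: (u *m Q) - b *: (v *m Q)) + b *: (b *: (u *m Q) + a *: (v *m Q)).
    by apply/rowP => i; rewrite !mxE; ring.
  by rewrite uQ vQ !scaler0 addr0.
have vQ0 : v *m Q = 0.
  apply/eqP; rewrite -[_ == 0]orFb -(negbTE ab0) -scaler_eq0.
  have -> : (a ^+ 2 + b ^+ 2) *: (v *m Q) =
      a *: (b *: (u *m Q) + a *: (v *m Q)) - b *: (a *: (u *m Q) - b *: (v *m Q)).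
    by apply/rowP => i; rewrite !mxE; ring.
  by rewrite uQ vQ !scaler0 subr0.
have uS : u *m S = a *: u - b *: v by rewrite -uB mulmxBr uQ0 subr0.
have vS : v *m S = b *: u + a *: v by rewrite -vB mulmxBr vQ0 subr0.
apply: gamma_ub => [|[a1 b0]]; first by exists u, v.
have fix0 (w : 'rV[R]_n) : w *m S = w -> w *m Q = 0 -> w = 0.
  by move=> /(S_T_fix oM oN al0 h1 h2 ne) /QP ->.
case: uv => /eqP; apply; apply: fix0 => //.
  by rewrite uS a1 b0 scale1r scale0r subr0.
by rewrite vS a1 b0 scale1r scale0r add0r.
Qed.

End Deflation.
End LinearizedOperator.

(** * Geometric decay of real sequences *)

Section Sequences.
Context {R : realType}.

Lemma geometric_dominated (a b C : R) : 0 <= a -> a < b ->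
  exists N, forall m, (N <= m)%N -> C * a ^+ m <= b ^+ m.
Proof.
move=> a0 ab; have b0 : 0 < b by apply: le_lt_trans ab.
have C1 : 0 < `|C| + 1 by rewrite ltr_wpDl.
have q1 : `|a / b| < 1 by rewrite ger0_norm ?divr_ge0 ?(ltW b0)// ltr_pdivrMr// mul1r.
have /cvgrPdist_lt/(_ (`|C| + 1)^-1) := cvg_expr q1.
rewrite invr_gt0 => /(_ C1)[N _ hN]; exists N => m /hN /=.
rewrite sub0r normrN ger0_norm ?exprn_ge0 ?divr_ge0 ?(ltW b0)// expr_div_n.
rewrite ltr_pdivrMr ?exprn_gt0// mulrC ltr_pdivlMr// => /ltW; apply: le_trans.
by rewrite mulrC ler_wpM2l ?exprn_ge0// (le_trans (ler_norm _))// lerDl.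
Qed.

Lemma block_contraction (d : nat -> R) (s : R) (m K : nat) :
  0 < s -> (0 < m)%N -> (forall k, 0 <= d k) ->
  (forall k, (K <= k)%N -> d (k + m)%N <= s ^+ m * d k) ->
  exists C, forall k, (K <= k)%N -> d k <= C * s ^+ k.
Proof.
(* [C] dominates the ratios on the first block K, ..., K + m - 1; later indices descend to it by
   steps of [m]. *)
move=> s0 m0 d0 hd; pose C := \sum_(j < K + m) d j / s ^+ j.
have term_ge0 j : 0 <= d j / s ^+ j by rewrite divr_ge0// exprn_ge0// ltW.
exists C => k; elim/ltn_ind: k => k IH Kk.
have [kK|Kmk] := ltnP k (K + m)%N.
  rewrite -ler_pdivrMr ?exprn_gt0// /C (bigD1 (Ordinal kK))//= lerDl.
  by apply: sumr_ge0 => j _.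
have mk : (m <= k)%N by apply: leq_trans Kmk; exact: leq_addl.
have Kkm : (K <= k - m)%N by rewrite leq_subRL// addnC.
rewrite -{1}(subnK mk); apply: (le_trans (hd _ Kkm)).
have := IH (k - m)%N; rewrite ltn_subrL m0 (leq_trans m0 mk) => /(_ isT Kkm) h.
apply: (le_trans (ler_wpM2l _ h)); first by rewrite exprn_ge0// ltW.
by rewrite mulrCA -exprD addnC subnK.
Qed.

End Sequences.

(** * Contraction towards the intersection *)

Section Contraction.
Context {R : realType}.

(** The factor s^m is shared out: a quarter for nonlinearity, a quarter for the component along [Q],
    a half for the powers of S - Q. The block length [m] is fixed before the sequence. *)
Lemma S_T_block_contraction n (M N : set 'rV[R]_n) xs (PM PN Q : 'M[R]_n) al al1 al2 s :
  closed (M `&` N) -> M xs -> N xs ->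
  orthoproj PM -> flat_at M xs PM -> orthoproj PN -> flat_at N xs PN ->
  orthoproj Q -> flat_at (M `&` N) xs Q ->
  (forall v : 'rV[R]_n, v *m Q = v <-> v *m PM = v /\ v *m PN = v) ->
  al != 0 -> 0 < al1 <= 2 -> 0 < al2 <= 2 -> al1 != 2 \/ al2 != 2 ->
  gamma (S_T_mx PM PN al al1 al2) < s ->
  exists2 m, (0 < m)%N & forall x : nat -> 'rV[R]_n,
    (forall j, S_step M N al al1 al2 (x j) (x j.+1)) -> x @ \oo --> xs ->
    exists K, forall k, (K <= k)%N ->
      dist_set (M `&` N) (x (k + m)%N) <= s ^+ m * dist_set (M `&` N) (x k).
Proof.
move=> cMN Mx Nx oM fM oN fN oQ fQ QP al0 h1 h2 ne.
set S := S_T_mx _ _ _ _ _ => gs; have g0 := gamma_ge0 S.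
have s0 : 0 < s by apply: le_lt_trans gs.
pose rho := (gamma S + s) / 2%:R.
have rho0 : 0 < rho by rewrite divr_gt0// ltr_wpDl.
have grho : gamma S < rho by rewrite ltr_pdivlMr//; lra.
have rhos : rho < s by rewrite ltr_pdivrMr//; lra.
have [|C C0 hC] := @power_bound R n (S - Q) rho rho0.
  move=> a b eig; apply: le_lt_trans grho.
  exact: (deflated_eigenvalue_le_gamma oM oN oQ QP al0 h1 h2 ne eig).
(* The factor 2 gives C rho^m <= s^m / 2; [m0.+1] makes the block length positive. *)
have [m0 hm0] := geometric_dominated (2%:R * C) (ltW rho0) rhos.
exists m0.+1 => // x Sx xxs; have {hm0} := hm0 _ (leqnSn m0).
move: m0.+1 => m hm; set q := s ^+ m; have q0 : 0 < q by rewrite exprn_gt0.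
have [Km Km0 hKm] := mulmx_bounded (S ^+ m).
have q4 : 0 < q / 4%:R by rewrite divr_gt0.
have qK : 0 < q / 4%:R / Km by rewrite divr_gt0.
have MNM : M `&` N `<=` M by move=> ? [].
have MNN : M `&` N `<=` N by move=> ? [].
have [r1 r10 hr1] := expands_iter m
  (expands_S_step al al1 al2 Mx Nx MNM MNN oM fM oN fN) q4.
have [r2 r20 hr2] := flat_proj_normal oQ fQ qK.
(* Halved because [p], no farther from [x k] than [xs] is, lies only within 2r of [xs]. *)
pose r := Num.min r1 r2 / 2%:R.
have r0 : 0 < r by rewrite divr_gt0// lt_min r10.
have rr : r + r <= Num.min r1 r2 by rewrite /r; move: (Num.min _ _) => a; lra.
move: rr; rewrite le_min => /andP[rr1 rr2].
have [K hK] := cvg_enormP xxs r0; exists K => k /hK xr.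
have MNxs : (M `&` N) xs by [].
have [p prj] := nearest_point (x k) cMN (ex_intro _ xs MNxs).
have [MNp pmin] := prj; rewrite (dist_set_proj prj).
apply: (le_trans (dist_set_le _ MNp)).
have pr : enorm (p - xs) < r + r.
  apply: le_lt_trans (ler_enormB _ (x k) _) _; rewrite (enormB p).
  by have := pmin xs MNxs; lra.
have {hr2} hQ : enorm ((x k - p) *m Q) <= q / 4%:R / Km * enorm (x k - p).
  by apply: hr2 => //; lra.
have {hr1} hS : enorm (x (k + m)%N - p - (x k - p) *m S ^+ m) <= q / 4%:R * enorm (x k - p).
  apply: hr1 => //; [|lra|lra].
  by exists (fun j => x (k + j)%N); rewrite addn0; split => // j; rewrite addnS.
move: (x k - p) hQ hS => h hQ hS.
have [_ QQ] := oQ.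
have hB : (h - h *m Q) *m S ^+ m = (h - h *m Q) *m (S - Q) ^+ m.
  by apply: (S_T_pow_deflated al al1 al2 oM oN oQ QP); rewrite mulmxBl -mulmxA QQ subrr.
have -> : x (k + m)%N - p =
    (x (k + m)%N - p - h *m S ^+ m) + h *m Q *m S ^+ m + (h - h *m Q) *m (S - Q) ^+ m.
  by rewrite -hB -addrA -mulmxDl [h *m Q + _]addrC !subrK.
do 2![apply: (le_trans (ler_enormD _ _)); rewrite -?lerBrDr].
have t1 := hKm (h *m Q); have t2 := hC m (h - h *m Q).
have t3 : Km * enorm (h *m Q) <= q / 4%:R * enorm h.
  by rewrite mulrC -ler_pdivlMr// mulrAC.
have t4 : C * rho ^+ m * enorm (h - h *m Q) <= q / 2%:R * enorm h.
  apply: ler_pM; rewrite ?enorm_ge0 ?orthoproj_compl_le//.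
    by rewrite mulr_ge0 ?exprn_ge0 ?ltW.
  by rewrite ler_pdivlMr// mulrC mulrA.
by lra.
Qed.

End Contraction.

Unset Implicit Arguments.

(** A rate [s] strictly between gamma and [mu] yields a bound C s^j; the gap between [s] and [mu]
    then absorbs the constant C. *)
Theorem theorem6 (R : realType) (n k : nat) (M N : set 'rV[R]_n)
    (xb : 'rV[R]_n) (al al1 al2 : R) :
  (2 <= k)%N ->
  closed M -> closed N ->
  regular_at k M N xb ->
  0 < al <= 1 -> 0 < al1 <= 2 -> 0 < al2 <= 2 ->
  ((al1 < 2 /\ al2 < 2) \/ (al < 1 /\ (al1 != 2 \/ al2 != 2))) ->
  exists delta : R, 0 < delta /\
    forall (x : nat -> 'rV[R]_n) (xs : 'rV[R]_n),
      enorm (x 0%N - xb) < delta ->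
      (forall j, S_step M N al al1 al2 (x j) (x j.+1)) ->
      x @ \oo --> xs ->
      regular_at k M N xs ->
      forall PM PN : 'M[R]_n,
        is_proj_mx (tangent M xs) PM -> is_proj_mx (tangent N xs) PN ->
        forall mu : R, gamma (S_T_mx PM PN al al1 al2) < mu < 1 ->
          exists N0 : nat, forall j, (N0 < j)%N ->
            dist_set (M `&` N) (x j) <= mu ^+ j.
Proof.
move=> k2 cM cN _ /andP[al0 _] h1 h2 hB; exists 1; split => // x xs _ Sx xxs.
move=> [mM [mN [mMN tMN]]] PM PN pM pN mu /andP[gmu _].
(* Both parameter regimes leave at least one relaxation that is not a full reflection. *)
have ne : al1 != 2 \/ al2 != 2.
  by case: hB => [[/lt_eqF -> _]|[_ //]]; left.
have k0 : (0 < k)%N by apply: leq_trans k2.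
have cMN : closed (M `&` N) by exact: closedI.
have [Mx _] := mM; have [Nx _] := mN; have [MNx _] := mMN.
have [PM' oM fM] := ck_manifold_flat k0 mM.
have [PN' oN fN] := ck_manifold_flat k0 mN.
have [Q oQ fQ] := ck_manifold_flat k0 mMN.
have tM := flat_tangent cM Mx oM fM; have tN := flat_tangent cN Nx oN fN.
have tQ := flat_tangent cMN MNx oQ fQ.
have EM : PM = PM' := is_proj_mx_orthoproj oM tM pM.
have EN : PN = PN' := is_proj_mx_orthoproj oN tN pN.
subst PM' PN'.
(* The tangent space condition at the limit enters here: [Q] projects onto the common fixed space of
   [PM] and [PN]. *)
have QP (v : 'rV[R]_n) : v *m Q = v <-> v *m PM = v /\ v *m PN = v.
  rewrite -tQ tMN; split => [[/tM ? /tN ?] //|[/tM ? /tN ?]]; by split.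
have g0 := gamma_ge0 (S_T_mx PM PN al al1 al2).
pose s := (gamma (S_T_mx PM PN al al1 al2) + mu) / 2%:R.
have gs : gamma (S_T_mx PM PN al al1 al2) < s by rewrite ltr_pdivlMr//; lra.
have smu : s < mu by rewrite ltr_pdivrMr//; lra.
have s0 : 0 < s by apply: le_lt_trans gs.
have [m m0 /(_ x Sx xxs)[K hK]] := S_T_block_contraction cMN Mx Nx oM fM oN fN oQ fQ QP
  (lt0r_neq0 al0) h1 h2 ne gs.
have d0 j : 0 <= dist_set (M `&` N) (x j).
  have [p prj] := nearest_point (x j) cMN (ex_intro _ xs MNx).
  by rewrite (dist_set_proj prj) enorm_ge0.
have [C hC] := block_contraction s0 m0 d0 hK.
have [N1 hN1] := geometric_dominated C (ltW s0) smu.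
exists (maxn K N1) => j; rewrite gtn_max => /andP[Kj Nj].
by apply: (le_trans (hC j (ltnW Kj))); apply: hN1; exact: ltnW.
Qed.
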